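(* Consider the online influence maximization problem on a directed graph with $n$ nodes and $m$ edges, under the linear threshold (LT) or the independent cascade (IC) model, and run the algorithm OIM-ETC with an $(\alpha,\beta)$-approximation offline oracle and exploration budget $k$ for $T$ rounds. (1) When $k=\max\left\{1,\frac{2m^2n^2}{\Delta_{\min}^2}\ln\left(\frac{T\Delta_{\min}^2}{mn^3}\right)\right\}$, the $\alpha\beta$-scaled regret satisfies $$R(T)\le\min\left\{T\Delta_{\max},\ n\Delta_{\max}+\frac{2m^2n^3\Delta_{\max}}{\Delta_{\min}^2}\left(1+\max\left\{0,\ln\left(\frac{T\Delta_{\min}^2}{mn^3}\right)\right\}\right)\right\}=O\left(\frac{m^2n^3\Delta_{\max}}{\Delta_{\min}^2}\ln(T)\right).$$ (2) When $k=3.9\,(m^2T/n)^{2/3}$, the $\alpha\beta$-scaled regret satisfies $$R(T)\le 3.9\,(mn)^{4/3}T^{2/3}+1=O\left((mn)^{4/3}T^{2/3}\right).$$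
   Context: $G=(V,E)$ is a finite directed graph, $n=|V|$, $m=|E|$; $e_{u,v}=(u,v)$; $N(v)$ and $N^{\mathrm{out}}(v)$ are the in- and out-neighbors of $v$. Each edge has a weight $w(e)\in[0,1]$. LT model from seed set $S$: each node $v$ independently draws $\theta_v$ uniform on $[0,1]$; $S_0=S$; at time $\tau+1$ every $v\notin S_\tau$ with $\sum_{u\in N(v)\cap S_\tau}w(e_{u,v})\ge\theta_v$ becomes active. For the LT model the true weights satisfy $\sum_{u\in N(v)}w(e_{u,v})\le1$ for all $v$. IC model: each edge $e$ is live independently with probability $w(e)$ and a node is active if it is reachable from $S$ through live edges (at time $\tau$ equal to its live-edge distance from $S$). In either model $r(S,w)$ is the expected final number of active nodes. Action set $\mathcal A=\{S\subset V:|S|\le K\}$ with $K\ge 1$; $\mathrm{Opt}_w=\max_{S\in\mathcal A}r(S,w)$. An offline oracle is an $(\alpha,\beta)$-approximation ($\alpha,\beta\in[0,1]$) if for every weight vector $w'$ its output $S'\in\mathcal A$ satisfies $\mathbb P(r(S',w')\ge\alpha\,\mathrm{Opt}_{w'})\ge\beta$. Online problem: $w$ is unknown; in each round $t$ the learner picks $S_t\in\mathcal A$ and a fresh independent diffusion from $S_t$ takes place, whose sets of active nodes at each time step are observed. Regret: $R(T)=\mathbb E\left[\alpha\beta\,T\,\mathrm{Opt}_w-\sum_{t=1}^T r(S_t,w)\right]$. Algorithm OIM-ETC (input $K$, $k$, $T$, oracle): for each $s\in\{1,\dots,k\}$ and each $u\in V$, play the seed set $\{u\}$ for one round and let $X_s(e_{u,v})=\mathbf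 1\{v\text{ is activated in the first diffusion step}\}$ for every $v\in N^{\mathrm{out}}(u)$. Then compute $\hat w(e)=\frac1k\sum_{s=1}^kX_s(e)$ for all $e\in E$, call the oracle once to obtain $\hat S=\mathrm{Oracle}(\hat w)$, and play $\hat S$ in all remaining $T-nk$ rounds (if $nk \ge T$ there are none and the algorithm stops after $T$ rounds). The prescribed values of $k$ are used as given (integrality is disregarded, i.e. $k$ is taken to be an integer equal to the stated value). Bad seed sets: $\mathcal S_B=\{S\in\mathcal A: r(S,w)<\alpha\,\mathrm{Opt}_w\}$, assumed nonempty. Gaps: $\Delta_{\max}=\alpha\,\mathrm{Opt}_w-\min\{r(S,w):S\in\mathcal S_B\}$ and $\Delta_{\min}=\alpha\,\mathrm{Opt}_w-\max\{r(S,w):S\in\mathcal S_B\}$. *)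

(* Defs.v *)
From HB Require Import structures.
From mathcomp Require Import all_boot all_order all_algebra.
From mathcomp Require Import all_classical all_reals all_analysis.

Set Implicit Arguments.
Unset Strict Implicit.
Unset Printing Implicit Defensive.

Import Order.TTheory GRing.Theory Num.Theory.
Import numFieldNormedType.Exports.

Local Open Scope classical_set_scope.
Local Open Scope ring_scope.

Inductive diffusion_model := LT | IC.

(* Iterated integral of F when the coordinates listed in s are replaced by
   uniform variables on [0, 1]: for s = enum V it is the expectation of F under
   independent uniform thresholds, whatever the initial theta. *)
Fixpoint unif_expectation (R : realType) (V : finType) (s : seq V)
    (F : (V -> R) -> \bar R) (theta : V -> R) : \bar R :=
  if s is v :: s' then
    (\int[uniform_prob (@ltr01 R)]_x
      unif_expectation s' F (fun u => if u == v then x else theta u))%E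
  else F theta.

Section Diffusion.
Variables (R : realType) (V : finType) (E : {set V * V}).
(* A weight vector is a function on all pairs, but only its values on E are
   ever used. *)
Implicit Types (w : V * V -> R) (S A : {set V}) (mdl : diffusion_model).

Definition is_weight w : Prop := forall e, e \in E -> 0 <= w e <= 1.

Definition lt_admissible w : Prop :=
  forall v, \sum_(u | (u, v) \in E) w (u, v) <= 1.

(* The sets of active nodes at times 0, 1, ..., #|V|; in both models a
   diffusion is stationary from time #|V| on. *)
Definition trace := (#|V|.+1).-tuple {set V}.

Definition state (y : trace) (tau : nat) : {set V} := nth finset.set0 y tau.

Definition final (y : trace) : {set V} := state y #|V|.

Definition lt_step w (theta : V -> R) A : {set V} :=
  A :|: [set v | (v \notin A) &&
                 (theta v <= \sum_(u in A | (u, v) \in E) w (u, v))]%SET.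

Definition lt_trace w (theta : V -> R) S : trace :=
  [tuple iter (i : 'I_#|V|.+1) (lt_step w theta) S | i < #|V|.+1].

(* Nodes at live-edge distance at most tau from S; L is the set of live
   edges. *)
Definition ic_state (L : {set V * V}) S (tau : nat) : {set V} :=
  [set v | [exists u in S, exists i : 'I_tau.+1, exists p : i.-tuple V,
     path (fun x y => (x, y) \in L) u p && (last u p == v)]]%SET.

Definition ic_trace (L : {set V * V}) S : trace :=
  [tuple ic_state L S i | i < #|V|.+1].

(* Probability that the diffusion from S under w has the trace y.  Under LT the
   in-weights of a node may add up to more than 1. *)
Definition diffusion_law mdl w S (y : trace) : R :=
  match mdl with
  | LT => fine (unif_expectation (enum V)
                  (fun theta => ((lt_trace w theta S == y)%:R : R)%:E)
                  (fun=> 0))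
  | IC => \sum_(L : {set V * V} | L \subset E)
            (\prod_(e in L) w e) * (\prod_(e in E :\: L) (1 - w e))
            * (ic_trace L S == y)%:R
  end.

Definition spread mdl w S : R :=
  \sum_(y : trace) diffusion_law mdl w S y * #|final y|%:R.

Definition feasible (K : nat) : {set {set V}} :=
  [set S : {set V} | (#|S| <= K)%N]%SET.

(* The spread of a weight vector takes values in [0, #|V|] and the empty seed set is feasible, so
   that the default values 0 and #|V|%:R of the maxima and minima below play no
   role as long as the sets they range over are nonempty. *)
Definition opt mdl (K : nat) w : R :=
  \big[Num.max/0]_(S in feasible K) spread mdl w S.

Definition bad_seeds mdl (K : nat) w (alpha : R) : {set {set V}} :=
  [set S in feasible K | spread mdl w S < alpha * opt mdl K w]%SET.

Definition gap_max mdl (K : nat) w (alpha : R) : R :=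
  alpha * opt mdl K w -
  \big[Num.min/#|V|%:R]_(S in bad_seeds mdl K w alpha) spread mdl w S.

Definition gap_min mdl (K : nat) w (alpha : R) : R :=
  alpha * opt mdl K w -
  \big[Num.max/0]_(S in bad_seeds mdl K w alpha) spread mdl w S.

(* oracle w' S is the probability that the (randomized) oracle outputs S on
   input w'. *)
Definition approximation_oracle mdl (K : nat) (alpha beta : R)
    (oracle : (V * V -> R) -> {set V} -> R) : Prop :=
  forall w', is_weight w' ->
    [/\ forall S, 0 <= oracle w' S,
        \sum_(S : {set V}) oracle w' S = 1,
        forall S, S \notin feasible K -> oracle w' S = 0 &
        beta <= \sum_(S : {set V} | alpha * opt mdl K w' <= spread mdl w' S)
                  oracle w' S].

(* The s-th exploration of u (s < k) takes place in this round, rounds being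
   numbered from 0. *)
Definition explore_round (s : nat) (u : V) : nat := (s * #|V| + enum_rank u)%N.

(* y t is the trace of the diffusion of round t. *)
Definition first_step (y : nat -> trace) (s : nat) (e : V * V) : bool :=
  let yt := y (explore_round s e.1) in
  e.2 \in state yt 1 :\: state yt 0.

Definition estimate (k : nat) (y : nat -> trace) (e : V * V) : R :=
  if e \in E then (\sum_(s < k) (first_step y s e)%:R) / k%:R else 0.

Section Run.
Context (d : measure_display) (Omega : measurableType d)
        (P : probability Omega R).
(* Seed set and observed trace of each round. *)
Variables (seed : nat -> Omega -> {set V}) (obs : nat -> Omega -> trace).

(* The event that the first t rounds went as described by h. *)
Definition past (t : nat) (h : nat -> {set V} * trace) : set Omega :=
  [set om | forall i, (i < t)%N -> seed i om = (h i).1 /\ obs i om = (h i).2].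

(* The last clause says that, given the past and the seed set of round t, the
   diffusion of round t is distributed as a diffusion from that seed set. *)
Definition online_run mdl w (T : nat) : Prop :=
  forall t, (t < T)%N ->
    [/\ forall A, measurable [set om | seed t om = A],
        forall y, measurable [set om | obs t om = y] &
        forall h A y,
          P (past t h `&` [set om | seed t om = A] `&` [set om | obs t om = y])
          = (P (past t h `&` [set om | seed t om = A])
             * (diffusion_law mdl w A y)%:E)%E].

(* In the second clause, oracle gives the law of the seed set of the first
   exploitation round conditionally on the exploration phase. *)
Definition plays_oim_etc (k T : nat)
    (oracle : (V * V -> R) -> {set V} -> R) : Prop :=
  [/\ forall s u om, (s < k)%N -> (explore_round s u < T)%N ->
        seed (explore_round s u) om = [set u]%SET,
      (#|V| * k < T)%N -> forall h A,
        P (past (#|V| * k) h `&` [set om | seed (#|V| * k) om = A])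
        = (P (past (#|V| * k) h)
           * (oracle (estimate k (fun i => (h i).2)) A)%:E)%E &
      forall t om, (#|V| * k < t < T)%N -> seed t om = seed (#|V| * k) om].

Definition regret mdl (K : nat) w (alpha beta : R) (T : nat) : \bar R :=
  'E_P[fun om => alpha * beta * T%:R * opt mdl K w
                 - \sum_(t < T) spread mdl w (seed t om)].

End Run.
End Diffusion.

(* Main.v *)
(* The expected spread is Lipschitz in the weights: changing the weight of the
   edges into one node v changes the final active set only if the activation of
   v by the final set of the cascade run without v changes, so the spread moves
   by at most L times the l1-distance of the weights, where L <= min(n, m) is
   the number of nodes with an in-edge.  This holds for all weights in [0, 1],
   even when the in-weights of a node add up to more than 1 under LT.

   The k explorations of the tail of an edge e that is not a self-loop are
   independent Bernoulli(w e) observations, so by Hoeffding the estimates are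
   all within Dmin / (2 m n) of the weights, except with probability at most
   2 m exp(- k Dmin^2 / (2 m^2 n^2)); otherwise an alpha-optimal seed set for
   the estimates is not bad.  For the bound without gaps, the expected loss of
   an exploitation round is at most 2 L times the expected l1-error, hence at
   most 3 m^2 / sqrt k: summed over the rounds this is less than k n, the slack
   left by bounding the loss of an exploration round by n - 1. *)
Require Import Defs.
From HB Require Import structures.
From mathcomp Require Import all_boot all_order all_algebra.
From mathcomp Require Import all_classical all_reals all_analysis.
From mathcomp Require Import ring lra.

Set Implicit Arguments.
Unset Strict Implicit.
Unset Printing Implicit Defensive.

Import Order.TTheory GRing.Theory Num.Theory.
Import numFieldNormedType.Exports.

Local Open Scope ring_scope.

(** * Expectation under a finite product law *)

Section ProductExpectation.
Variables (R : realType) (I J : finType).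
Implicit Types (p : J -> R) (mu : I -> J -> R) (H : {ffun I -> J} -> R).
Implicit Types (g : {ffun I -> J}).

Definition is_dist p := (forall j, 0 <= p j) /\ \sum_j p j = 1.

Definition prod_exp mu H : R :=
  \sum_(g : {ffun I -> J}) (\prod_i mu i (g i)) * H g.

Definition update g i j : {ffun I -> J} :=
  [ffun i' => if i' == i then j else g i'].

(** For [p] the law of coordinate [i], this is the conditional expectation of [H] given the other
    coordinates. It stays a function of the full [g], so that averages can be iterated without
    changing the index type. *)
Definition average p i H g : R := \sum_j p j * H (update g i j).

Lemma update_same g i j : update g i j i = j.
Proof. by rewrite ffunE eqxx. Qed.

Lemma update_id g i : update g i (g i) = g.
Proof. by apply/ffunP => i'; rewrite ffunE; case: eqP => [->|]. Qed.

Lemma update_update g i j j' : update (update g i j) i j' = update g i j'.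
Proof. by apply/ffunP => i'; rewrite !ffunE; case: eqP. Qed.

(* The involution (g, j) |-> (update g i j, g i) exchanges the two sides. *)
Lemma prod_exp_resample mu1 mu2 i H :
  (forall i', i' != i -> mu1 i' =1 mu2 i') -> \sum_j mu1 i j = 1 ->
  prod_exp mu1 (average (mu2 i) i H) = prod_exp mu2 H.
Proof.
move=> mu12 sum1.
pose K (x : {ffun I -> J} * J) :=
  (\prod_i' mu1 i' (x.1 i')) * (mu2 i x.2 * H (update x.1 i x.2)).
pose swap (x : {ffun I -> J} * J) := (update x.1 i x.2, x.1 i).
have swapK : involutive swap.
  by case=> g j; rewrite /swap /= update_update update_same update_id.
have -> : prod_exp mu1 (average (mu2 i) i H) = \sum_x K x.
  rewrite -(pair_bigA _ (fun (g : {ffun I -> J}) j => K (g, j))) /=.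
  by apply: eq_bigr => g _; rewrite /average big_distrr.
have -> : prod_exp mu2 H = \sum_(x : {ffun I -> J} * J)
      (\prod_i' mu2 i' (x.1 i')) * H x.1 * mu1 i x.2.
  rewrite -(pair_bigA _
    (fun (g : {ffun I -> J}) j => (\prod_i' mu2 i' (g i')) * H g * mu1 i j)) /=.
  by apply: eq_bigr => g _; rewrite -big_distrr /= sum1 mulr1.
rewrite (reindex_inj (inv_inj swapK)) /=; apply: eq_bigr => -[g j] _.
rewrite /K /= update_update update_id.
rewrite (bigD1 i) //= update_same [in RHS](bigD1 i) //=.
have -> : \prod_(i0 | i0 != i) mu1 i0 (update g i j i0) =
          \prod_(i0 | i0 != i) mu2 i0 (g i0).
  by apply: eq_bigr => i' ii'; rewrite ffunE (negbTE ii') mu12.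
ring.
Qed.

Lemma prod_exp_factor mu (phi : I -> J -> R) :
  prod_exp mu (fun g => \prod_i phi i (g i)) =
  \prod_i \sum_j mu i j * phi i j.
Proof.
rewrite bigA_distr_bigA /=; apply: eq_bigr => g _.
by rewrite big_split.
Qed.

Lemma eq_prod_exp mu H H' : H =1 H' -> prod_exp mu H = prod_exp mu H'.
Proof. by move=> HH'; apply: eq_bigr => g _; rewrite HH'. Qed.

Lemma prod_expZl mu a H : prod_exp mu (fun g => a * H g) = a * prod_exp mu H.
Proof. by rewrite big_distrr; apply: eq_bigr => g _; rewrite mulrCA. Qed.

Lemma prod_expZr mu a H : prod_exp mu (fun g => H g * a) = prod_exp mu H * a.
Proof. by rewrite big_distrl; apply: eq_bigr => g _; rewrite mulrA. Qed.

Lemma prod_expD mu H H' :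
  prod_exp mu (fun g => H g + H' g) = prod_exp mu H + prod_exp mu H'.
Proof. by rewrite -big_split; apply: eq_bigr => g _; rewrite mulrDr. Qed.

Lemma prod_expB mu H H' :
  prod_exp mu (fun g => H g - H' g) = prod_exp mu H - prod_exp mu H'.
Proof. by rewrite -sumrB; apply: eq_bigr => g _; rewrite mulrBr. Qed.

Lemma prod_exp_sum mu (T : finType) (Q : pred T)
    (F : T -> {ffun I -> J} -> R) :
  prod_exp mu (fun g => \sum_(x | Q x) F x g) =
  \sum_(x | Q x) prod_exp mu (F x).
Proof.
rewrite exchange_big /=; apply: eq_bigr => g _.
by rewrite big_distrr.
Qed.

Section Dist.
Variable mu : I -> J -> R.
Hypothesis mu_dist : forall i, is_dist (mu i).

Lemma prod_exp_cst a : prod_exp mu (fun=> a) = a.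
Proof.
rewrite -[RHS]mulr1 -[in LHS](mulr1 a) prod_expZl; congr (_ * _).
transitivity (\prod_i \sum_j mu i j); last first.
  by apply: big1 => i _; rewrite (mu_dist i).2.
rewrite bigA_distr_bigA /=.
by apply: eq_bigr => g _; rewrite mulr1.
Qed.

(** An outcome with a coordinate of probability 0 has weight 0 in the sum. The restriction matters
    later: the one-coordinate bounds hold only for outcomes such as monotone activation rules. *)
Lemma prod_exp_le_supp H H' :
  (forall g, (forall i, mu i (g i) != 0) -> H g <= H' g) ->
  prod_exp mu H <= prod_exp mu H'.
Proof.
move=> HH'; apply: ler_sum => g _.
have [->|nz] := eqVneq (\prod_i mu i (g i)) 0; first by rewrite !mul0r.
rewrite ler_wpM2l ?prodr_ge0 // => [i _|]; first by have [->] := mu_dist i.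
by apply: HH' => i; move/prodf_neq0: nz; exact.
Qed.

Lemma prod_exp_le H H' : (forall g, H g <= H' g) ->
  prod_exp mu H <= prod_exp mu H'.
Proof. by move=> HH'; apply: prod_exp_le_supp. Qed.

(** Resampling coordinate [i] turns the integrand into a constant. *)
Lemma prod_exp_marginal i (phi : J -> R) :
  prod_exp mu (fun g => phi (g i)) = \sum_j mu i j * phi j.
Proof.
rewrite -(@prod_exp_resample mu mu i) ?(mu_dist i).2 //.
under eq_prod_exp => g.
  rewrite /average; under eq_bigr do rewrite update_same; over.
exact: prod_exp_cst.
Qed.

End Dist.

(* Telescoping: the laws are replaced one coordinate at a time. *)
Lemma prod_exp_hybrid mu1 mu2 (P : I -> pred J) H (delta : I -> R) :
  (forall i, is_dist (mu1 i)) -> (forall i, is_dist (mu2 i)) ->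
  (forall i j, ~~ P i j -> mu1 i j = 0) ->
  (forall i j, ~~ P i j -> mu2 i j = 0) ->
  (forall i g, (forall i', P i' (g i')) ->
     `|average (mu2 i) i H g - average (mu1 i) i H g| <= delta i) ->
  `|prod_exp mu2 H - prod_exp mu1 H| <= \sum_i delta i.
Proof.
move=> d1 d2 P1 P2 HH.
pose mix (s : seq I) i := if i \in s then mu2 i else mu1 i.
have dmix s i : is_dist (mix s i) by rewrite /mix; case: ifP.
suff step s : uniq s ->
    `|prod_exp (mix s) H - prod_exp mu1 H| <= \sum_(i <- s) delta i.
  have := step (index_enum I) (index_enum_uniq I).
  suff -> : prod_exp (mix (index_enum I)) H = prod_exp mu2 H by [].
  by apply: eq_bigr => g _; congr (_ * _); apply: eq_bigr => i _;
    rewrite /mix mem_index_enum.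
elim: s => [_|i s IH /= /andP[iNs us]].
  by rewrite big_nil [prod_exp (mix [::]) H]/prod_exp subrr normr0.
rewrite big_cons -[X in `|X|](subrKA (prod_exp (mix s) H)).
apply: le_trans (ler_normD _ _) _; apply: lerD; last exact: IH.
have mixs i' : i' != i -> mix (i :: s) i' = mix s i'.
  by move=> ii'; rewrite /mix inE (negbTE ii').
(* Both expectations are moved to the common law [mix s], coordinate [i] being resampled from
   [mu2 i] in one and from [mu1 i] in the other; their difference is then a single expectation of a
   difference of averages. *)
rewrite -(@prod_exp_resample (mix s) (mix (i :: s)) i H); last 2 first.
- by move=> i' /mixs ->.
- by rewrite (dmix _ _).2.
rewrite -[X in _ - X](@prod_exp_resample (mix s) (mix s) i H) //;
  last by rewrite (dmix _ _).2.
rewrite -prod_expB.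
have -> : mix (i :: s) i = mu2 i by rewrite /mix mem_head.
have -> : mix s i = mu1 i by rewrite /mix (negbTE iNs).
have PP g : (forall i, mix s i (g i) != 0) -> forall i, P i (g i).
  move=> nz i'; apply: contraT => nP; have := nz i'.
  by rewrite /mix; case: ifP => _; rewrite ?P1 ?P2 ?eqxx.
rewrite ler_norml; apply/andP; split.
  rewrite -(@prod_exp_cst (mix s) _ (- delta i)) //.
  apply: prod_exp_le_supp => // g /PP Pg.
  by have := HH i g Pg; rewrite ler_norml => /andP[].
rewrite -(@prod_exp_cst (mix s) _ (delta i)) //.
apply: prod_exp_le_supp => // g /PP Pg.
by have := HH i g Pg; rewrite ler_norml => /andP[].
Qed.

End ProductExpectation.

(** * Deterministic cascades *)

Section Cascade.
Variable V : finType.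
Implicit Types (f : V -> {set V} -> bool) (S A B H : {set V}) (v : V).

(** Common form of both models: [f v A] says that the active set [A] activates [v], and LT and IC
    differ only in how the rule [f] is drawn. *)
Definition cascade_step f A : {set V} :=
  (A :|: [set v | (v \notin A) && f v A])%SET.

Definition cascade_trace f S : trace V :=
  [tuple iter (i : 'I_#|V|.+1) (cascade_step f) S | i < #|V|.+1].

Definition cascade_end f S : {set V} := iter #|V| (cascade_step f) S.

Definition monotone_activation f :=
  forall v A B, A \subset B -> f v A -> f v B.

Lemma state_mktuple (F : nat -> {set V}) t : (t <= #|V|)%N ->
  state [tuple F (i : 'I_#|V|.+1) | i < #|V|.+1] t = F t.
Proof.
rewrite -ltnS => tV; rewrite /state.
by rewrite -[t in LHS]/(nat_of_ord (Ordinal tV)) -tnth_nth tnth_mktuple.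
Qed.

Lemma state_cascade f S t : (t <= #|V|)%N ->
  state (cascade_trace f S) t = iter t (cascade_step f) S.
Proof. exact: (state_mktuple (fun t => iter t (cascade_step f) S)). Qed.

Lemma final_cascade f S : final (cascade_trace f S) = cascade_end f S.
Proof. exact: state_cascade. Qed.

Lemma in_cascade_step f A v : (v \in cascade_step f A) = (v \in A) || f v A.
Proof. by rewrite !inE; case: (v \in A). Qed.

Lemma sub_cascade_step f A : A \subset cascade_step f A.
Proof. exact: finset.subsetUl. Qed.

Lemma sub_cascade_end f S : S \subset cascade_end f S.
Proof.
rewrite /cascade_end; elim: #|V| => //= t IH.
exact: fintype.subset_trans IH (sub_cascade_step _ _).
Qed.

Lemma eq_cascade_step f f' A : (forall v, v \notin A -> f v A = f' v A) ->
  cascade_step f A = cascade_step f' A.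
Proof.
move=> ff'; apply/finset.setP => v; rewrite !inE.
by case: (boolP (v \in A)) => //= /ff' ->.
Qed.

Lemma eq_cascade_end f f' S : (forall v A, v \notin A -> f v A = f' v A) ->
  cascade_end f S = cascade_end f' S.
Proof.
move=> ff'; rewrite /cascade_end; elim: #|V| => //= t ->.
by apply: eq_cascade_step => v; exact: ff'.
Qed.

Lemma cascade_end_sub f S H : (forall v A, f v A -> v \in H) ->
  cascade_end f S \subset S :|: H.
Proof.
move=> fH; rewrite /cascade_end; elim: #|V| => [|t IH] /=.
  exact: finset.subsetUl.
apply/fintype.subsetP => v; rewrite !inE => /orP[/(fintype.subsetP IH)|/andP[_ /fH ->]].
  by rewrite !inE.
by rewrite orbT.
Qed.

(** Every step that is not stationary adds a node, so after [t.+1] steps either the last one changed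
    nothing or more than [t] nodes are active; for [t] equal to [#|V|] the second case is
    impossible. *)
Lemma cascade_end_fixed f S :
  cascade_step f (cascade_end f S) = cascade_end f S.
Proof.
rewrite /cascade_end; set st := cascade_step f.
suff H t : iter t.+1 st S = iter t st S \/ (t < #|iter t.+1 st S|)%N.
  have [//|] := H #|V|.
  by rewrite ltnNge max_card.
elim: t => [|t IH] /=.
- have [->|neq] := eqVneq (st S) S; [by left|right].
  suff : S \proper st S by move=> /proper_card; exact: leq_trans.
  by rewrite finset.properEneq eq_sym neq sub_cascade_step.
- have [->|neq] := eqVneq (st (st (iter t st S))) (st (iter t st S)).
    by left.
  right.
  case: IH => [/= eqt|lt]; first by rewrite eqt eqt eqxx in neq.
  apply: (leq_ltn_trans lt); apply: proper_card.
  by rewrite finset.properEneq eq_sym neq sub_cascade_step.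
Qed.

Lemma cascade_end_closed f S v :
  f v (cascade_end f S) -> v \in cascade_end f S.
Proof.
move=> fv; rewrite -cascade_end_fixed !inE fv andbT.
by case: (v \in _).
Qed.

(** Together with [cascade_end_closed], this makes the final set the least superset of [S] closed
    under [f], which is how cascades with different rules are compared. *)
Lemma cascade_end_least f S B : monotone_activation f ->
  S \subset B -> (forall v, f v B -> v \in B) -> cascade_end f S \subset B.
Proof.
move=> fm SB fB; rewrite /cascade_end; elim: #|V| => //= t IH.
apply/fintype.subsetP => v; rewrite !inE => /orP[/(fintype.subsetP IH) //|/andP[_ fv]].
exact/fB/(fm _ _ _ IH).
Qed.

Definition switch_off f v0 v A := (v != v0) && f v A.
Definition switch_on f v0 v A := (v == v0) || f v A.

Lemma switch_off_monotone f v0 :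
  monotone_activation f -> monotone_activation (switch_off f v0).
Proof. by move=> fm v A B AB /andP[vv0 /(fm _ _ _ AB) fv]; apply/andP. Qed.

Lemma switch_on_monotone f v0 :
  monotone_activation f -> monotone_activation (switch_on f v0).
Proof.
by move=> fm v A B AB /orP[/eqP->|/(fm _ _ _ AB) fv];
  rewrite /switch_on ?eqxx // fv orbT.
Qed.

(* The final set depends on the activation rule of v0 only through its value
   at the final set of the cascade in which v0 is never activated. *)
Lemma cascade_end_switch f v0 S : monotone_activation f ->
  cascade_end f S =
  if f v0 (cascade_end (switch_off f v0) S)
  then cascade_end (switch_on f v0) S else cascade_end (switch_off f v0) S.
Proof.
move=> fm; set B := cascade_end (switch_off f v0) S.
have Bf : B \subset cascade_end f S.
  apply: cascade_end_least (switch_off_monotone fm) (sub_cascade_end _ _) _.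
  by move=> v /andP[_]; exact: cascade_end_closed.
apply/eqP; rewrite finset.eqEsubset; case: ifPn => fv; apply/andP; split.
- apply: cascade_end_least fm (sub_cascade_end _ _) _ => v fv'.
  by apply: cascade_end_closed; rewrite /switch_on fv' orbT.
- apply: cascade_end_least (switch_on_monotone fm) (sub_cascade_end _ _) _.
  move=> v /orP[/eqP->|]; last exact: cascade_end_closed.
  exact/cascade_end_closed/(fm _ _ _ Bf).
- apply: cascade_end_least fm (sub_cascade_end _ _) _ => v fv'.
  apply: cascade_end_closed; rewrite /switch_off fv' andbT.
  by apply: contraNneq fv => <-.
- exact: Bf.
Qed.

(** A seed is active from the start, so its rule is never consulted. Hence the weights into a seed
    do not affect the spread. *)
Lemma switch_seed f v0 S : v0 \in S ->
  cascade_end (switch_on f v0) S = cascade_end (switch_off f v0) S.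
Proof.
move=> v0S; rewrite /cascade_end.
suff H t : iter t (cascade_step (switch_on f v0)) S =
             iter t (cascade_step (switch_off f v0)) S /\
           v0 \in iter t (cascade_step (switch_off f v0)) S by case: (H #|V|).
elim: t => //= t [-> v0t]; split; last by rewrite inE v0t.
apply: eq_cascade_step => v vt; rewrite /switch_on /switch_off.
by case: (eqVneq v v0) vt => [->|//]; rewrite v0t.
Qed.

Lemma mem_switch_off f v0 S :
  v0 \in cascade_end (switch_off f v0) S -> v0 \in S.
Proof.
rewrite /cascade_end; elim: #|V| => //= t IH.
by rewrite !inE /switch_off eqxx andbF orbF.
Qed.

(** Both cardinalities lie between [#|S|] and [#|S| + #|H|]. With [H] the set of nodes that have an
    in-edge, this gives the Lipschitz constant of the spread. *)
Lemma card_end_diff (R : realDomainType) f f' S H :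
  (forall v A, f v A -> v \in H) -> (forall v A, f' v A -> v \in H) ->
  `|#|cascade_end f S|%:R - #|cascade_end f' S|%:R : R| <= #|H|%:R.
Proof.
move=> fH f'H.
have up (g : V -> {set V} -> bool) : (forall v A, g v A -> v \in H) ->
    (#|cascade_end g S| <= #|S| + #|H|)%N.
  move=> /(cascade_end_sub S)/subset_leq_card/leq_trans; apply.
  by rewrite -cardsUI leq_addr.
have lo (g : V -> {set V} -> bool) : (#|S| <= #|cascade_end g S|)%N.
  exact/subset_leq_card/sub_cascade_end.
rewrite ler_norml; apply/andP; split.
  rewrite lerBrDl lerBlDr -natrD ler_nat.
  by rewrite (leq_trans (up _ f'H)) // leq_add2r.
by rewrite lerBlDr -natrD ler_nat addnC (leq_trans (up _ fH)) // leq_add2r.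
Qed.

End Cascade.

(** * Finite-valued random variables *)

Section FiniteRange.
Local Open Scope classical_set_scope.
Variables (R : realType) (d : measure_display) (T : measurableType d).
Variables (P : probability T R) (J : finType) (c : T -> J).
Hypothesis mc : forall j, measurable [set x | c x = j].

Definition pmf j : R := fine (P [set x | c x = j]).

(** The integrand is a finite combination of indicators of the level sets of [c]. This is the
    passage from integrals to finite sums, for thresholds as well as for runs. *)
Lemma integral_finite_range (phi : J -> R) :
  (\int[P]_x (phi (c x))%:E = (\sum_j pmf j * phi j)%:E)%E.
Proof.
transitivity (\int[P]_x
    (\sum_j (phi j)%:E * (\1_[set x | c x = j] x)%:E))%E.
  apply: eq_integral => x _; rewrite (bigD1 (c x)) //= indicE mem_set //.
  rewrite mule1 big1 ?adde0 // => j jcx; rewrite indicE memNset ?mule0 //.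
  by move=> /= cx; rewrite cx eqxx in jcx.
rewrite integral_sum //; last first.
  by move=> j; apply: integrableZl => //; exact: integrable_indic.
rewrite -sumEFin; apply: eq_bigr => j _.
rewrite integralZl //; last exact: integrable_indic.
by rewrite integral_indic // setIT EFinM muleC /pmf fineK // fin_num_measure.
Qed.

Lemma measurable_finite_range (Q : pred J) : measurable [set x | Q (c x)].
Proof.
have -> : [set x | Q (c x)] = \bigcup_(j in [set j | Q j]) [set x | c x = j].
  by apply/seteqP; split=> [x Qx|x [j Qj /= ->]] //; exists (c x).
by apply: fin_bigcup_measurable => //; exact: finite_finset.
Qed.

Lemma pmf_pred (Q : pred J) :
  \sum_j pmf j * (Q j)%:R = fine (P [set x | Q (c x)]).
Proof.
rewrite -[LHS]/(fine (_)%:E) -integral_finite_range.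
rewrite -[X in P X]setIT -integral_indic //; last exact: measurable_finite_range.
congr fine; apply: eq_integral => x _; rewrite indicE.
congr (_%:R%:E); have [Qx|Qx] := boolP (Q (c x)); first by rewrite mem_set.
by rewrite memNset //; exact/negP.
Qed.

Lemma pmf_dist : is_dist pmf.
Proof.
split=> [j|]; first by rewrite fine_ge0.
under eq_bigr do rewrite -[pmf _]mulr1.
have := pmf_pred xpredT; rewrite /= => ->.
have -> : [set x | true] = [set: T] by apply/seteqP; split.
by rewrite probability_setT.
Qed.

End FiniteRange.

(** * Distribution function of a uniform threshold *)

Section Uniform.
Local Open Scope classical_set_scope.

Lemma uniform_prob_le (R : realType) (a : R) : 0 <= a ->
  fine (uniform_prob (@ltr01 R) [set x | x <= a]) = Num.min 1 a.
Proof.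
move=> a0; rewrite /uniform_prob integral_uniform_pdf.
rewrite (_ : _ `&` _ = `[0, Num.min 1 a]); last first.
  apply/seteqP; split=> x /=; rewrite !in_itv /= le_min.
    by move=> [xa /andP[-> ->]].
  by move=> /andP[-> /andP[-> ->]].
rewrite (@eq_integral _ _ _ _ _ (cst 1%:E)); last first.
  move=> x; rewrite inE /= in_itv /= le_min.
  by move=> /andP[x0 /andP[x1 _]]; rewrite /uniform_pdf x0 x1 subr0 invr1.
rewrite integral_cst // mul1e [X in fine X]lebesgue_measure_itv /= lte_fin oppr0 adde0.
have [|] := ltP 0 (Num.min 1 a) => //.
rewrite le_eqVlt => /predU1P[-> //|].
by rewrite gt_min ltNge ler01 /= ltNge a0.
Qed.

End Uniform.

(** * The linear threshold model *)

Section UnifExpectation.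
Variables (R : realType) (V J : finType) (c : V -> R -> J).
Hypothesis mc :
  forall v j, measurable [set x : measurableTypeR R | c v x = j]%classic.

(** A threshold matters only through its finite-valued image under [c v]; the law of that image
    replaces the uniform law. *)
Definition cell_law v : J -> R := pmf (uniform_prob (@ltr01 R)) (c v).

Lemma cell_law_dist v : is_dist (cell_law v).
Proof. by apply: pmf_dist => j; exact: mc. Qed.

Definition averages (s : seq V) (G : {ffun V -> J} -> R) :=
  foldr (fun v => average (cell_law v) v) G s.

Lemma averages_ext (s : seq V) G (g g' : {ffun V -> J}) :
  (forall v, v \notin s -> g v = g' v) -> averages s G g = averages s G g'.
Proof.
elim: s g g' => [|v s IH] g g' gg' /=.
  by congr G; apply/ffunP => v; rewrite gg'.
apply: eq_bigr => j _; congr (_ * _); apply: IH => u us.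
by rewrite !ffunE; case: eqVneq => // uv; rewrite gg' // inE negb_or uv.
Qed.

Lemma unif_expectation_averages G s F theta :
  (forall theta, F theta = (G [ffun v => c v (theta v)])%:E) ->
  unif_expectation s F theta = (averages s G [ffun v => c v (theta v)])%:E.
Proof.
move=> FG; elim: s theta => [|v s IH] theta //=.
rewrite -[RHS](integral_finite_range (uniform_prob (@ltr01 R)) (mc v)
  (fun j => averages s G (update [ffun u => c u (theta u)] v j))).
apply: eq_integral => x _; rewrite IH; congr (averages _ _ _)%:E.
by apply/ffunP => u; rewrite !ffunE; case: eqP => [->|].
Qed.

(** The iterated integral is an iterated average. Averaging one coordinate over its own law
    preserves the product expectation, and once all coordinates are averaged the function is
    constant, hence equal to its expectation. *)
Lemma unif_expectation_prod_exp G F theta :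
  (forall theta, F theta = (G [ffun v => c v (theta v)])%:E) ->
  unif_expectation (enum V) F theta = (prod_exp cell_law G)%:E.
Proof.
move=> FG; rewrite (unif_expectation_averages _ _ FG) //; congr _%:E.
set g := finfun _.
have <- : prod_exp cell_law (averages (enum V) G) = prod_exp cell_law G.
  elim: (enum V) => //= v s <-.
  by rewrite prod_exp_resample // (cell_law_dist _).2.
rewrite -[LHS](prod_exp_cst cell_law_dist); apply: eq_prod_exp => g'.
by apply: averages_ext => v; rewrite mem_enum.
Qed.

End UnifExpectation.

Section LinearThreshold.
Variables (R : realType) (V : finType) (E : {set V * V}).
Implicit Types (w : V * V -> R) (S A B : {set V}) (v : V).

Definition heads : {set V} := [set v | [exists u, (u, v) \in E]].

Definition influence w v A : R := \sum_(u in A | (u, v) \in E) w (u, v).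

(* The activation rule of v determined by the threshold x: the sets A of active
   nodes that activate v. Unlike thresholds, rules form a finite type. *)
Definition activation w v (x : R) : {ffun {set V} -> bool} :=
  [ffun A => x <= influence w v A].

(** A rule equals [j] unless it differs from [j] at some [A]; there are finitely many [A], and for
    each the exceptional thresholds form a ray. *)
Lemma measurable_activation w v j :
  measurable [set x : measurableTypeR R | activation w v x = j]%classic.
Proof.
rewrite (_ : mkset _ =
    (~` \bigcup_(A in [set: {set V}])
          [set x : measurableTypeR R | (x <= influence w v A) != j A])%classic);
  last first.
  apply/seteqP; split=> x /=.
    by move=> <- [A _] /=; rewrite ffunE eqxx.
  move=> nex; apply/ffunP => A; rewrite ffunE; apply/eqP.
  by apply: contrapT => /negP neq; apply: nex; exists A.
apply: measurableC; apply: fin_bigcup_measurable => [|A _].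
  exact: finite_finset.
case: (j A).
  rewrite (_ : mkset _ = `]influence w v A, +oo[%classic); last first.
    by apply/seteqP; split=> x; rewrite /= in_itv /= andbT ltNge; case: (x <= _).
  exact: measurable_itv.
rewrite (_ : mkset _ = `]-oo, influence w v A]%classic); last first.
  by apply/seteqP; split=> x; rewrite /= in_itv /=; case: (x <= _).
exact: measurable_itv.
Qed.

Definition activation_law w v := cell_law (activation w) v.

Lemma activation_law_dist w v : is_dist (activation_law w v).
Proof. by apply: cell_law_dist => u j; exact: measurable_activation. Qed.

Lemma diffusion_law_LT w S y :
  diffusion_law E LT w S y =
  prod_exp (activation_law w)
    (fun g => (cascade_trace (fun v A => g v A) S == y)%:R).
Proof.
rewrite /= (@unif_expectation_prod_exp _ _ _ _ (measurable_activation w)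
  (fun g => (cascade_trace (fun v A => g v A) S == y)%:R)) // => theta.
congr ((_ == y)%:R)%:E; apply/eq_from_tnth => i; rewrite !tnth_mktuple.
elim: (nat_of_ord i) => //= t ->.
by apply/finset.setP => v; rewrite !inE !ffunE.
Qed.

Lemma influence_ge0 w v A : is_weight E w -> 0 <= influence w v A.
Proof. by move=> wE; apply: sumr_ge0 => u /andP[_ /wE /andP[]]. Qed.

Lemma influence_not_head w v A : v \notin heads -> influence w v A = 0.
Proof.
rewrite inE negb_exists => /forallP nh; apply: big1 => u /andP[_ uv].
by have := nh u; rewrite uv.
Qed.

Lemma influence_le w v A B : is_weight E w -> A \subset B ->
  influence w v A <= influence w v B.
Proof.
move=> wE AB; rewrite /influence big_mkcond [leRHS]big_mkcond /=.
apply: ler_sum => u _; case: ifPn => [/andP[/(fintype.subsetP AB) -> ->] //|_].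
by case: ifP => // /andP[_ /wE /andP[]].
Qed.

Lemma activation_law_mem w v A : is_weight E w ->
  \sum_j activation_law w v j * (j A)%:R = Num.min 1 (influence w v A).
Proof.
move=> wE; rewrite -uniform_prob_le ?influence_ge0 //.
rewrite /activation_law /cell_law.
rewrite (pmf_pred _ (measurable_activation w v) (fun j => j A)).
by congr (fine (uniform_prob _ _)); apply/seteqP; split=> x; rewrite /= ffunE.
Qed.

(* Only the threshold 0 activates a node without in-neighbour. *)
Definition lt_support v (j : {ffun {set V} -> bool}) :=
  [forall A : {set V}, forall B : {set V}, (A \subset B) ==> j A ==> j B] &&
  ((v \in heads) || [forall A, ~~ j A]).

Lemma activation_law_support w v j : is_weight E w ->
  ~~ lt_support v j -> activation_law w v j = 0.
Proof.
move=> wE; rewrite /lt_support negb_and => /orP[|].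
  move=> nm; rewrite /activation_law /cell_law /pmf.
  rewrite (_ : mkset _ = set0) ?measure0 //.
  apply/seteqP; split=> // x /= xj; move: nm => /negP; apply.
  apply/forallP => A; apply/forallP => B; apply/implyP => AB.
  by rewrite -xj !ffunE; apply/implyP => /le_trans; apply; exact: influence_le.
rewrite negb_or => /andP[vh]; rewrite negb_forall => /existsP[A].
rewrite negbK => jA.
(* The probability that [A] activates [v] is 0 and is a sum of nonnegative terms, so each rule that
   accepts [A] has probability 0. *)
have := activation_law_mem v A wE; rewrite influence_not_head // min_r //.
have [nn _] := activation_law_dist w v.
move=> /eqP; rewrite psumr_eq0; last by move=> i _; rewrite mulr_ge0.
by move=> /allP /(_ j); rewrite mem_index_enum jA mulr1 => /(_ isT) /eqP.
Qed.

Lemma lipschitz_min1 (x y : R) : `|Num.min 1 x - Num.min 1 y| <= `|x - y|.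
Proof.
have [x1|x1] := leP 1 x; have [y1|y1] := leP 1 y.
- by rewrite subrr normr0.
- by rewrite !ger0_norm; lra.
- by rewrite !ler0_norm; lra.
- by [].
Qed.

(** With the other rules fixed, the final set depends on the rule of [v] only through its value at
    the final set [B] of the cascade without [v]. The averaged size is therefore affine in the
    activation probability [Num.min 1 (influence w v B)], with a slope of at most the number of
    heads. *)
Lemma lt_single_node w w' S v (g : {ffun V -> {ffun {set V} -> bool}}) :
  is_weight E w -> is_weight E w' -> (forall u, lt_support u (g u)) ->
  let H (g : {ffun V -> {ffun {set V} -> bool}}) : R :=
    #|cascade_end (fun u A => g u A) S|%:R in
  `|average (activation_law w' v) v H g - average (activation_law w v) v H g|
    <= #|heads|%:R *
       \sum_(u | ((u, v) \in E) && (u != v)) `|w' (u, v) - w (u, v)|.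
Proof.
move=> wE w'E gs; cbv zeta; set H := fun _ => _.
pose f u A := g u A.
set B := cascade_end (switch_off f v) S.
set c0 : R := #|B|%:R; set c1 : R := #|cascade_end (switch_on f v) S|%:R.
have gm j : lt_support v j ->
    monotone_activation (fun u A => update g v j u A).
  move=> js u A A' AA'; rewrite ffunE.
  suff: lt_support u (if u == v then j else g u).
    by case/andP=> /forallP/(_ A)/forallP/(_ A')/implyP/(_ AA')/implyP.
  by case: eqP => [->|_].
have Hj j : lt_support v j -> H (update g v j) = c0 + (c1 - c0) * (j B)%:R.
  move=> js; rewrite /H (cascade_end_switch v S (gm _ js)).
  rewrite (@eq_cascade_end _ (switch_off _ v) (switch_off f v)); last first.
    by move=> u A _; rewrite /switch_off /f; case: (eqVneq u v) => //= uv;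
      rewrite ffunE (negbTE uv).
  rewrite (@eq_cascade_end _ (switch_on _ v) (switch_on f v)); last first.
    by move=> u A _; rewrite /switch_on /f; case: (eqVneq u v) => //= uv;
      rewrite ffunE (negbTE uv).
  rewrite update_same -/B; case: (j B); rewrite ?mulr1 ?mulr0 ?addr0 //.
  by rewrite addrC subrK.
have avE w0 : is_weight E w0 -> average (activation_law w0 v) v H g =
    c0 + (c1 - c0) * Num.min 1 (influence w0 v B).
  move=> w0E; rewrite -activation_law_mem // mulr_sumr.
  have c0E : c0 = \sum_j activation_law w0 v j * c0.
    by rewrite -mulr_suml (activation_law_dist w0 v).2 mul1r.
  rewrite [X in X + _]c0E.
  rewrite -big_split /=; apply: eq_bigr => j _.
  have [js|/activation_law_support ->] := boolP (lt_support v j) => //.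
    by rewrite Hj // mulrDr mulrCA.
  by rewrite !mul0r mulr0 addr0.
rewrite !avE // opprD addrACA subrr add0r -mulrBr normrM.
(* If [v] is a seed the slope [c1 - c0] vanishes; if [v] has no in-edge both influences vanish. *)
have [vS|vNS] := boolP (v \in S).
  by rewrite /c1 /c0 switch_seed // subrr normr0 mul0r mulr_ge0 // sumr_ge0.
have [vh|vNh] := boolP (v \in heads); last first.
  by rewrite !influence_not_head // subrr normr0 mulr0 mulr_ge0 // sumr_ge0.
apply: ler_pM => //.
  apply: card_end_diff => u A; rewrite /switch_on /switch_off.
    move=> /orP[/eqP->//|]; have /andP[_ /orP[//|/forallP/(_ A)/negP]] := gs u.
    by [].
  move=> /andP[_]; have /andP[_ /orP[//|/forallP/(_ A)/negP]] := gs u.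
  by [].
apply: le_trans (lipschitz_min1 _ _) _.
rewrite /influence -sumrB; apply: le_trans (ler_norm_sum _ _ _) _.
rewrite big_mkcond [leRHS]big_mkcond /=; apply: ler_sum => u _.
(* The node [v] is not in [B], as it is neither a seed nor ever activated there, so a self-loop at
   [v] does not contribute to the influence of [B]. *)
case: ifPn => [/andP[uB ->] /=|_]; last by case: ifP.
case: eqVneq uB => [->|//] /mem_switch_off vS; by rewrite vS in vNS.
Qed.

Lemma sum_edges (F : V * V -> R) :
  \sum_v \sum_(u | ((u, v) \in E) && (u != v)) F (u, v) =
  \sum_(e in E | e.1 != e.2) F e.
Proof.
rewrite (exchange_big_dep xpredT) //= pair_big_dep /=.
by apply: eq_big => [[u v]|[u v] _].
Qed.

End LinearThreshold.

(** * The independent cascade model and the spread *)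

Section IndependentCascade.
Variables (R : realType) (V : finType) (E : {set V * V}).
Implicit Types (w : V * V -> R) (S A B : {set V}) (L : {set V * V}) (v : V).

Lemma ic_stateP L S t v : reflect
  (exists u p, [/\ u \in S, (size p <= t)%N,
     path (fun x y => (x, y) \in L) u p & last u p = v])
  (v \in ic_state L S t).
Proof.
rewrite inE; apply: (iffP existsP) => [[u /andP[uS]]|[u [p [uS pt pp pv]]]].
  move=> /existsP[i /existsP[p /andP[pp /eqP pv]]].
  by exists u, p; split=> //; rewrite size_tuple -ltnS.
exists u; rewrite uS /=; apply/existsP.
exists (Ordinal (pt : (size p < t.+1)%N)); apply/existsP.
by exists (in_tuple p); rewrite /= pp pv eqxx.
Qed.

Definition live_activation (g : {ffun V * V -> bool}) v A :=
  [exists u in A, g (u, v)].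

Definition edge_set (g : {ffun V * V -> bool}) : {set V * V} :=
  [set e | g e].

(** Induction on time, splitting off the last edge of a live path. *)
Lemma ic_state_cascade g S t :
  ic_state (edge_set g) S t = iter t (cascade_step (live_activation g)) S.
Proof.
elim: t => [|t IH] /=; apply/finset.setP => v.
  apply/ic_stateP/idP => [[u [p [uS]]]|vS].
    by case: p => //= _ _ <-.
  by exists v, [::].
rewrite -IH in_cascade_step; apply/ic_stateP/orP => [[u [p [uS]]]|].
  rewrite leq_eqVlt => /orP[|pt pp pv]; last by left; apply/ic_stateP; exists u, p.
  case/lastP: p => // p x; rewrite size_rcons eqSS rcons_path last_rcons inE.
  move=> /eqP pt /andP[pp lx] <-; right.
  apply/existsP; exists (last u p); rewrite lx andbT.
  by apply/ic_stateP; exists u, p; rewrite pt.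
case=> [/ic_stateP[u [p [uS pt pp pv]]]|].
  by exists u, p; split=> //; exact: leqW.
move=> /existsP[x /andP[/ic_stateP[u [p [uS pt pp pv]]] xv]].
exists u, (rcons p v); split; rewrite ?size_rcons ?rcons_path ?last_rcons //.
by rewrite pp pv inE.
Qed.

(** Pairs outside [E] are almost surely not live, so that all pairs can index the product law. *)
Definition edge_law w e (b : bool) : R :=
  if e \in E then (if b then w e else 1 - w e) else (~~ b)%:R.

Lemma edge_law_dist w e : is_weight E w -> is_dist (edge_law w e).
Proof.
move=> wE; rewrite /edge_law /is_dist big_bool; case: ifPn => [/wE /andP[w0 w1]|_].
  by split=> [[|]|]; rewrite ?subr_ge0 //= addrC subrK.
by split=> [[|]|]; rewrite //= add0r.
Qed.

Lemma diffusion_law_IC w S y :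
  diffusion_law E IC w S y =
  prod_exp (edge_law w)
    (fun g => (cascade_trace (live_activation g) S == y)%:R).
Proof.
rewrite /= (reindex (fun g : {ffun V * V -> bool} => edge_set g)) /=; last first.
  exists (fun L => [ffun e => e \in L]) => [g _|L _].
    by apply/ffunP => e; rewrite ffunE inE.
  by apply/finset.setP => e; rewrite inE ffunE.
rewrite /prod_exp big_mkcond /=; apply: eq_bigr => g _.
have -> : ic_trace (edge_set g) S = cascade_trace (live_activation g) S.
  apply/eq_from_tnth => i; rewrite !tnth_mktuple; exact: ic_state_cascade.
case: ifPn => [gE|gNE]; last first.
  move: gNE => /subsetPn[e]; rewrite inE => ge eE.
  by rewrite (bigD1 e) //= /edge_law (negbTE eE) ge /= !mul0r.
congr (_ * _).
rewrite [RHS](bigID (mem E)) /= [X in _ = _ * X]big1 ?mulr1 => [|e eE]; last first.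
  rewrite /edge_law (negbTE eE); suff -> : g e = false by [].
  by apply: contraNF eE => ge; apply: (fintype.subsetP gE); rewrite inE.
rewrite [RHS](bigID (mem (edge_set g))) /=; congr (_ * _).
  apply: eq_big => [e|e].
    by apply/idP/andP => [ge|[]//]; split=> //; exact: (fintype.subsetP gE).
  move=> ge; rewrite /edge_law (fintype.subsetP gE) //.
  by move: ge; rewrite inE => ->.
apply: eq_big => [e|e]; first by rewrite finset.in_setD andbC.
by rewrite finset.in_setD inE => /andP[/negbTE ge eE]; rewrite /edge_law eE ge.
Qed.

(** The average over the state of [e] is affine in the weight of [e], with slope the change in final
    size when [e] becomes live. *)
Lemma ic_single_edge w w' S e (g : {ffun V * V -> bool}) :
  is_weight E w -> is_weight E w' -> (forall e', (e' \in E) || ~~ g e') ->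
  let H (g : {ffun V * V -> bool}) : R :=
    #|cascade_end (live_activation g) S|%:R in
  `|average (edge_law w' e) e H g - average (edge_law w e) e H g| <=
    if (e \in E) && (e.1 != e.2) then #|heads E|%:R * `|w' e - w e| else 0.
Proof.
move=> wE w'E gs; cbv zeta; set H := fun _ => _.
rewrite /average !big_bool /= /edge_law.
case: ifPn => [eE|eNE] /=; last by rewrite subrr normr0.
rewrite (_ : _ - _ = (H (update g e true) - H (update g e false)) *
  (w' e - w e)); last by ring.
case: ifPn => [ee|/negPn/eqP ee].
  rewrite normrM ler_wpM2r //; apply: card_end_diff => v A.
    move=> /existsP[u /andP[_]]; rewrite ffunE inE => uv.
    apply/existsP; exists u; move: uv; case: eqP => [-> //|_ uv].
    by have := gs (u, v); rewrite uv orbF.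
  move=> /existsP[u /andP[_]]; rewrite ffunE inE => uv.
  apply/existsP; exists u; move: uv; case: eqP => [//|_ uv].
  by have := gs (u, v); rewrite uv orbF.
(* A self-loop could activate its node only when that node is already active, so the two cascades
   coincide. *)
rewrite /H (@eq_cascade_end _ _ (live_activation (update g e false))).
  by rewrite subrr mul0r normr0.
move=> v A vA; apply: eq_existsb => u; have [uA|//] := boolP (u \in A).
rewrite !ffunE; case: eqP => // uve; move: ee uA vA.
by rewrite -uve /= => -> ->.
Qed.

End IndependentCascade.

(** * Spread and first diffusion step, for both models *)

Section DiffusionLaw.
Variables (R : realType) (V : finType) (E : {set V * V}).
Implicit Types (w : V * V -> R) (S A B : {set V}) (v : V).

Lemma diffusion_law_cascade mdl w S : is_weight E w ->
  exists (I J : finType) (mu : I -> J -> R)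
         (f : {ffun I -> J} -> V -> {set V} -> bool),
    (forall i, is_dist (mu i)) /\ forall y, diffusion_law E mdl w S y =
      prod_exp mu (fun g => (cascade_trace (f g) S == y)%:R).
Proof.
move=> wE; case: mdl.
  exists V, {ffun {set V} -> bool}, (activation_law E w),
    (fun (g : {ffun V -> {ffun {set V} -> bool}}) u A => g u A).
  by split=> [v|y]; [exact: activation_law_dist|exact: diffusion_law_LT].
exists (V * V)%type, (bool : finType), (edge_law E w), (@live_activation V).
by split=> [v|y]; [exact: edge_law_dist|exact: diffusion_law_IC].
Qed.

Lemma sum_prod_exp_eq (I J T : finType) (mu : I -> J -> R)
    (X : {ffun I -> J} -> T) (phi : T -> R) :
  \sum_y prod_exp mu (fun g => (X g == y)%:R) * phi y =
  prod_exp mu (fun g => phi (X g)).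
Proof.
under eq_bigr do rewrite -prod_expZr.
rewrite -prod_exp_sum; apply: eq_prod_exp => g.
rewrite (bigD1 (X g)) //= eqxx mul1r big1 ?addr0 // => y.
by rewrite eq_sym => /negbTE ->; rewrite mul0r.
Qed.

Lemma diffusion_law_dist mdl w S : is_weight E w ->
  is_dist (diffusion_law E mdl w S).
Proof.
move=> /(diffusion_law_cascade mdl S)[I [J [mu [f [dmu lawE]]]]]; split=> [y|].
  by rewrite lawE -[leLHS](prod_exp_cst dmu); apply: prod_exp_le.
under eq_bigr do rewrite lawE -[prod_exp _ _]mulr1.
by rewrite (sum_prod_exp_eq mu _ (fun=> 1)) prod_exp_cst.
Qed.

Lemma spread_ge_card mdl w S : is_weight E w ->
  #|S|%:R <= spread E mdl w S.
Proof.
move=> /(diffusion_law_cascade mdl S)[I [J [mu [f [dmu lawE]]]]].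
rewrite /spread; under eq_bigr do rewrite lawE.
rewrite sum_prod_exp_eq -[leLHS](prod_exp_cst dmu).
apply: prod_exp_le => // g; rewrite ler_nat final_cascade.
exact/subset_leq_card/sub_cascade_end.
Qed.

Lemma spread_le_card mdl w S : is_weight E w ->
  spread E mdl w S <= #|V|%:R.
Proof.
move=> /(diffusion_law_cascade mdl S)[I [J [mu [f [dmu lawE]]]]].
rewrite /spread; under eq_bigr do rewrite lawE.
rewrite sum_prod_exp_eq -[leRHS](prod_exp_cst dmu).
by apply: prod_exp_le => // g; rewrite ler_nat max_card.
Qed.

Lemma spread_ge0 mdl w S : is_weight E w -> 0 <= spread E mdl w S.
Proof. by move=> /(spread_ge_card mdl S); exact: le_trans. Qed.

(** Under LT the influence of the single seed [u] on [v] is [w (u, v)], which is at most 1 and so is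
    the activation probability itself. Under IC, [v] is activated in the first step exactly when the
    edge is live. *)
Lemma first_step_prob mdl w u v : is_weight E w -> (u, v) \in E -> u != v ->
  \sum_y diffusion_law E mdl w [set u]%SET y *
    (v \in state y 1 :\: state y 0)%:R = w (u, v).
Proof.
move=> wE uv neq; have V0 : (0 < #|V|)%N by apply/card_gt0P; exists u.
have step f : (v \in state (cascade_trace f [set u]%SET) 1 :\:
    state (cascade_trace f [set u]%SET) 0) = f v [set u]%SET.
  rewrite finset.in_setD !state_cascade //= in_cascade_step finset.in_set1.
  by rewrite eq_sym (negbTE neq).
have /andP[w0 w1] := wE _ uv.
case: mdl.
  under eq_bigr do rewrite diffusion_law_LT.
  rewrite (sum_prod_exp_eq _ _ (fun y => (v \in state y 1 :\: state y 0)%:R)).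
  under eq_prod_exp do rewrite step.
  rewrite (prod_exp_marginal (activation_law_dist E w) v
    (fun j : {ffun {set V} -> bool} => (j [set u]%SET)%:R)).
  rewrite activation_law_mem // /influence.
  rewrite (eq_bigl (pred1 u)) ?big_pred1_eq ?min_r // => x /=.
  by rewrite inE; case: eqP => // ->; rewrite uv.
under eq_bigr do rewrite diffusion_law_IC.
rewrite (sum_prod_exp_eq _ _ (fun y => (v \in state y 1 :\: state y 0)%:R)).
under eq_prod_exp do rewrite step.
have live g : live_activation g v [set u]%SET = g (u, v).
  apply/existsP/idP => [[x /andP[]]|guv]; first by rewrite inE => /eqP ->.
  by exists u; rewrite inE eqxx.
under eq_prod_exp do rewrite live.
rewrite (prod_exp_marginal (fun e => edge_law_dist e wE) (u, v)
  (fun b : bool => b%:R)).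
by rewrite big_bool /= /edge_law uv mulr1 mulr0 addr0.
Qed.

(* Self-loops are left out of the sum: they never activate a node, and since
   they are never observed live their weights cannot be estimated. *)
Lemma spread_lipschitz mdl w w' S : is_weight E w -> is_weight E w' ->
  `|spread E mdl w' S - spread E mdl w S| <=
  #|heads E|%:R * \sum_(e in E | e.1 != e.2) `|w' e - w e|.
Proof.
move=> wE w'E; rewrite /spread; case: mdl.
  under eq_bigr do rewrite diffusion_law_LT.
  under [X in _ - X]eq_bigr do rewrite diffusion_law_LT.
  rewrite !sum_prod_exp_eq.
  under eq_prod_exp do rewrite final_cascade.
  under [X in _ - X]eq_prod_exp do rewrite final_cascade.
  rewrite -(sum_edges E (fun e => `|w' e - w e|)) mulr_sumr.
  apply: (@prod_exp_hybrid _ _ _ _ _ (lt_support E)).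
  - exact: activation_law_dist.
  - exact: activation_law_dist.
  - by move=> v j; exact: activation_law_support.
  - by move=> v j; exact: activation_law_support.
  - by move=> v g gs; exact: lt_single_node.
under eq_bigr do rewrite diffusion_law_IC.
under [X in _ - X]eq_bigr do rewrite diffusion_law_IC.
rewrite !sum_prod_exp_eq.
under eq_prod_exp do rewrite final_cascade.
under [X in _ - X]eq_prod_exp do rewrite final_cascade.
rewrite mulr_sumr big_mkcond /=.
apply: (@prod_exp_hybrid _ _ _ _ _ (fun e b => (e \in E) || ~~ b)).
- by move=> e; exact: edge_law_dist.
- by move=> e; exact: edge_law_dist.
- by move=> e [|]; rewrite ?orbT // orbF => /negbTE eE; rewrite /edge_law eE.
- by move=> e [|]; rewrite ?orbT // orbF => /negbTE eE; rewrite /edge_law eE.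
- by move=> e g gs; exact: ic_single_edge.
Qed.

Lemma card_heads_nodes : (#|heads E| <= #|V|)%N.
Proof. exact: max_card. Qed.

Lemma card_heads_edges : (#|heads E| <= #|E|)%N.
Proof.
apply: leq_trans (leq_imset_card snd E); apply/subset_leq_card/fintype.subsetP => v.
by rewrite inE => /existsP[u uv]; apply/imsetP; exists (u, v).
Qed.

End DiffusionLaw.

(** * Hoeffding's inequality *)

Section BernoulliMgf.
Variable R : realType.
Implicit Types (p t s x : R) (f : R -> R).

Lemma le_of_is_derive f f' : (forall x, is_derive x 1 f (f' x)) ->
  (forall x, 0 <= x -> 0 <= f' x) -> forall t, 0 <= t -> f 0 <= f t.
Proof.
move=> df f'0 t t0.
apply: (@ger0_derive1_ndecr _ f 0 t) => //.
- move=> x; rewrite in_itv /= => /andP[x0 _].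
  by rewrite derive1E (@derive_val _ _ _ _ _ _ _ (df x)) f'0 // ltW.
- apply: derivable_within_continuous => x _.
  exact: (@ex_derive _ _ _ _ _ _ _ (df x)).
Qed.

Let D p s := 1 - p + p * expR s.

Let D_gt0 p s : 0 <= p <= 1 -> 0 < D p s.
Proof.
move=> /andP[p0 p1]; rewrite /D; have := expR_gt0 s.
have [->|pn] := eqVneq p 1; first by rewrite subrr add0r mul1r.
move=> es; apply: ltr_pwDl; last by rewrite mulr_ge0 // ltW.
by rewrite subr_gt0 lt_neqAle pn.
Qed.

Let is_derive_D p s : is_derive s 1 (D p) (p * expR s).
Proof.
rewrite /D; apply: is_derive_eq.
by rewrite /GRing.scale /=; ring.
Qed.

(** The difference [G] of the two sides vanishes at 0 and has derivative [K]; [K] vanishes at 0 and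
    has a nonnegative derivative. *)
Lemma bernoulli_cgf p t : 0 <= p <= 1 -> 0 <= t ->
  ln (D p t) <= t * p + t ^+ 2 / 8.
Proof.
move=> p01; pose K s := s / 4 + (p - 1) + (1 - p) * (D p s)^-1.
pose G s := s ^+ 2 / 8 + s * p - ln (D p s).
have K0 s : 0 <= s -> 0 <= K s.
  move=> s0; have K00 : K 0 = 0 by rewrite /K /D expR0 mulr1 subrK invr1; ring.
  rewrite -[leLHS]K00.
  pose K' x := 4^-1 - (1 - p) * ((D p x) ^- 2 * (p * expR x)).
  have dK x : is_derive x 1 K (K' x).
    have := D_gt0 x p01; move=> /lt0r_neq0 D0.
    have := is_derive_D p x => dD.
    rewrite /K; apply: is_derive_eq.
    by rewrite /K' /GRing.scale /=; ring.
  apply: (le_of_is_derive dK _ s0) => x _; have D0 := D_gt0 x p01.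
  rewrite subr_ge0 mulrCA ler_pdivrMl ?exprn_gt0 //.
  (* The arithmetic-geometric mean inequality: $D^2 \ge 4 (1 - p) p e^x$. *)
  have := sqr_ge0 (1 - p - p * expR x); rewrite /D; lra.
have dG x : is_derive x 1 G (K x).
  have D0 := D_gt0 x p01.
  have := is_derive_D p x => dD.
  have := is_derive1_ln D0 => dl.
  rewrite /G; apply: is_derive_eq.
  rewrite /K /GRing.scale /=; have := lt0r_neq0 D0; rewrite /D => ?; field => //.
move=> t0; have := le_of_is_derive dG K0 t0.
rewrite /G /D expR0 mulr1 subrK ln1 !(expr0n, mul0r) /= !addr0 subr0; lra.
Qed.

(* Hoeffding's lemma for a Bernoulli variable *)
Lemma bernoulli_mgf p t : 0 <= p <= 1 ->
  p * expR (t * (1 - p)) + (1 - p) * expR (t * (0 - p)) <= expR (t ^+ 2 / 8).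
Proof.
have pos q s : 0 <= q <= 1 -> 0 <= s ->
    q * expR (s * (1 - q)) + (1 - q) * expR (s * (0 - q)) <= expR (s ^+ 2 / 8).
  move=> q01 s0; have := bernoulli_cgf q01 s0; rewrite -ler_expR.
  rewrite lnK ?posrE ?D_gt0 // expRD /D => H.
  have -> : s * (1 - q) = s - s * q by ring.
  have -> : s * (0 - q) = - (s * q) by ring.
  rewrite expRD expRN mulrA -mulrDl ler_pdivrMr ?expR_gt0 //.
  by rewrite [leRHS]mulrC [leLHS]addrC.
(* A negative [t] is reduced to [- t] by exchanging success and failure, that is [p] and [1 - p]. *)
move=> p01; have [t0|t0] := leP 0 t; first exact: pos.
have q01 : 0 <= 1 - p <= 1 by move: p01 => /andP[? ?]; apply/andP; split; lra.
have nt0 : 0 <= - t by rewrite oppr_ge0 ltW.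
have := pos _ _ q01 nt0; rewrite sqrrN addrC.
have -> : - t * (1 - (1 - p)) = t * (0 - p) by ring.
have -> : - t * (0 - (1 - p)) = t * (1 - p) by ring.
by have -> : 1 - (1 - p) = p by ring.
Qed.

End BernoulliMgf.

Section Concentration.
Variables (R : realType) (I T : finType) (mu : I -> T -> R).
Variables (k : nat) (pos : 'I_k -> I) (B : pred T) (p : R).
Hypothesis mu_dist : forall i, is_dist (mu i).
Hypothesis pos_inj : injective pos.
Hypothesis B_prob : forall s, \sum_y mu (pos s) y * (B y)%:R = p.
Hypothesis p01 : 0 <= p <= 1.
Implicit Types (t eps : R) (g : {ffun I -> T}).

Definition deviation g : R := \sum_(s < k) ((B (g (pos s)))%:R - p).

(** The exponential factors over the coordinates. As [pos] is injective, a coordinate carries either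
    one factor, bounded by Hoeffding's lemma, or the empty product 1. *)
Lemma deviation_mgf t :
  prod_exp mu (fun g => expR (t * deviation g)) <= expR (k%:R * (t ^+ 2 / 8)).
Proof.
pose phi y : R := expR (t * ((B y)%:R - p)).
have phiE s : \sum_y mu (pos s) y * phi y <= expR (t ^+ 2 / 8).
  apply: le_trans (bernoulli_mgf t p01); rewrite le_eqVlt; apply/orP; left.
  apply/eqP.
  have NB_prob : \sum_y mu (pos s) y * (1 - (B y)%:R) = 1 - p.
    under eq_bigr do rewrite mulrBr mulr1.
    by rewrite sumrB B_prob (mu_dist _).2.
  rewrite -[X in _ = X * _ + _](B_prob s) -[X in _ = _ + X * _]NB_prob.
  rewrite !mulr_suml -big_split /=; apply: eq_bigr => y _; rewrite /phi.
  by case: (B y); rewrite /= ?subrr ?subr0 ?mulr1 ?mulr0 ?mul0r ?addr0 ?add0r.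
rewrite (eq_prod_exp _ (H' := fun g =>
    \prod_i \prod_(s | pos s == i) phi (g i))); last first.
  move=> g; rewrite /deviation mulr_sumr expR_sum.
  rewrite (partition_big pos xpredT) //=; apply: eq_bigr => i _.
  by apply: eq_bigr => s /eqP <-.
rewrite (prod_exp_factor mu (fun i y => \prod_(s | pos s == i) phi y)) /=.
have -> : expR (k%:R * (t ^+ 2 / 8)) =
    \prod_i \prod_(s | pos s == i) expR (t ^+ 2 / 8).
  transitivity (\prod_(s < k) expR (t ^+ 2 / 8)); last first.
    by rewrite (partition_big pos xpredT).
  by rewrite prodr_const card_ord expRM_natl.
apply: ler_prod => i _; apply/andP; split.
  apply: sumr_ge0 => y _; rewrite mulr_ge0 ?prodr_ge0 //; first by case: (mu_dist i).
  by move=> s _; exact: expR_ge0.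
have [s /eqP si|none] := pickP (fun s => pos s == i).
  have prod1 (c : R) : \prod_(s' | pos s' == i) c = c.
    by rewrite (big_pred1 s) // => s'; rewrite -si (inj_eq pos_inj).
  by under eq_bigr do rewrite prod1; rewrite prod1 -si.
have prod0 (c : R) : \prod_(s' | pos s' == i) c = 1 by rewrite big_pred0.
by under eq_bigr do rewrite prod0 mulr1; rewrite prod0 (mu_dist i).2.
Qed.

Lemma deviation_tail eps : 0 <= eps ->
  prod_exp mu (fun g => (k%:R * eps <= `|deviation g|)%R%:R) <=
  2 * expR (- (2 * k%:R * eps ^+ 2)).
Proof.
(* This [t] minimizes the Chernoff exponent [k * (t ^+ 2 / 8) - t * (k * eps)], with minimum
   [- (2 * k * eps ^+ 2)]. The factor 2 comes from the two tails. *)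
move=> eps0; pose t := 4 * eps.
apply: (@le_trans _ _ (prod_exp mu (fun g => expR (- (t * (k%:R * eps))) *
    (expR (t * deviation g) + expR ((- t) * deviation g))))).
  apply: prod_exp_le => // g; have [le_dev|_] := boolP (k%:R * eps <= `|deviation g|); last first.
    by apply: mulr_ge0; rewrite ?addr_ge0 ?expR_ge0.
  rewrite mulrDr -!expRD; move: le_dev; set z := deviation g => le_dev.
  have t0 : 0 <= t by rewrite mulr_ge0.
  have [z0|z0] := leP 0 z.
    rewrite -[leLHS]addr0 lerD ?expR_ge0 // -[leLHS]expR0 ler_expR.
    by move: le_dev; rewrite ger0_norm // => /(ler_wpM2l t0); lra.
  rewrite -[leLHS]add0r lerD ?expR_ge0 // -[leLHS]expR0 ler_expR.
  by move: le_dev; rewrite ltr0_norm // => /(ler_wpM2l t0); rewrite mulrN mulNr; lra.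
rewrite prod_expZl prod_expD.
have H1 := deviation_mgf t; have H2 := deviation_mgf (- t).
rewrite sqrrN in H2.
apply: le_trans (ler_wpM2l (expR_ge0 _) (lerD H1 H2)) _.
have twice (a b : R) : a * (b + b) = 2 * (a * b) by ring.
rewrite twice -expRD ler_wpM2l // ler_expR /t.
by rewrite le_eqVlt; apply/orP; left; apply/eqP; field.
Qed.

Lemma deviation_mean : (0 < k)%N ->
  prod_exp mu (fun g => `|deviation g|) <= 3 / 2 * Num.sqrt k%:R.
Proof.
move=> k0; set r := Num.sqrt k%:R.
have r0 : 0 < r by rewrite sqrtr_gt0 ltr0n.
have rr : r ^+ 2 = k%:R by rewrite sqr_sqrtr.
(* With this [t] both exponential moments are at most $e^{1/2} \le 2$. Since $t|z| \le e^{tz} +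
   e^{-tz} - 1$, the mean of $t|z|$ is at most 3. *)
pose t := 2 / r; have t0 : 0 < t by rewrite divr_gt0.
have half2 : expR (k%:R * (t ^+ 2 / 8)) <= 2 :> R.
  have -> : k%:R * (t ^+ 2 / 8) = 1 / 2.
    by rewrite -rr /t; field; rewrite lt0r_neq0.
  rewrite -[_ / _]opprK expRN -[leRHS]invrK lef_pV2 ?posrE ?expR_gt0 ?invr_gt0 //.
  apply: le_trans (expR_ge1Dx _); lra.
have H1 := le_trans (deviation_mgf t) half2.
have H2 : prod_exp mu (fun g => expR ((- t) * deviation g)) <= 2.
  by apply: le_trans (deviation_mgf (- t)) _; rewrite sqrrN.
rewrite -(ler_pM2l t0) -prod_expZl.
apply: (@le_trans _ _ (prod_exp mu (fun g =>
    expR (t * deviation g) + expR ((- t) * deviation g) - 1))).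
  apply: prod_exp_le => // g; set z := deviation g.
  have := expR_ge1Dx (t * z); have := expR_ge1Dx (- t * z).
  have := expR_ge0 (t * z); have := expR_ge0 (- t * z).
  by have [z0|z0] := leP 0 z; rewrite ?(ger0_norm z0) ?(ltr0_norm z0); lra.
rewrite prod_expB prod_expD prod_exp_cst //.
have -> : t * (3 / 2 * r) = 3 by rewrite /t; field; rewrite lt0r_neq0.
by lra.
Qed.

End Concentration.

(** * The law of a run *)

Section OnlineRun.
Variables (R : realType) (V : finType) (E : {set V * V}).
Variables (d : measure_display) (Omega : measurableType d).
Variables (P : probability Omega R).
Variables (seed : nat -> Omega -> {set V}) (obs : nat -> Omega -> trace V).
Variables (mdl : diffusion_model) (w : V * V -> R) (T k : nat).
Variable oracle : (V * V -> R) -> {set V} -> R.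
Hypothesis run : online_run E P seed obs mdl w T.
Hypothesis plays : plays_oim_etc E P seed obs k T oracle.

Let N := (#|V| * k)%N.

(* A singleton when V is nonempty; as a set it needs no default node. *)
Definition explored (i : nat) : {set V} :=
  [set v | (enum_rank v : nat) == (i %% #|V|)%N].

Lemma explored_round s (u : V) : explored (explore_round s u) = [set u]%SET.
Proof.
apply/finset.setP => v; rewrite !inE /explore_round modnMDl.
by rewrite modn_small // (inj_eq val_inj) (inj_eq enum_rank_inj).
Qed.

Lemma explore_round_lt (s : 'I_k) (u : V) : (explore_round s u < N)%N.
Proof.
rewrite /explore_round /N; apply: (@leq_trans (s.+1 * #|V|)).
  by rewrite mulSn addnC ltn_add2r.
by rewrite mulnC leq_mul2l ltn_ord orbT.
Qed.

Lemma explore_round_inj (u : V) : injective (fun s => explore_round s u).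
Proof.
have V0 : (0 < #|V|)%N by apply/card_gt0P; exists u.
by move=> s s' /addIn /eqP; rewrite eqn_pmul2r // => /eqP.
Qed.

Lemma seed_explored i om : (i < N)%N -> (i < T)%N -> seed i om = explored i.
Proof.
move=> iN iT; have V0 : (0 < #|V|)%N by move: iN; rewrite /N; case: #|V|.
pose u := enum_val (Ordinal (ltn_pmod i V0)).
have iE : i = explore_round (i %/ #|V|)%N u.
  by rewrite /explore_round enum_valK -divn_eq.
have [seedE _ _] := plays.
rewrite [in LHS]iE seedE -?iE //; last by rewrite ltn_divLR // mulnC.
by rewrite -(explored_round (i %/ #|V|)) -iE.
Qed.

Section Past.
Variable h : nat -> {set V} * trace V.

Lemma past_recr t : past seed obs t.+1 h =
  (past seed obs t h `&` [set om | seed t om = (h t).1]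
     `&` [set om | obs t om = (h t).2])%classic.
Proof.
apply/seteqP; split=> [om hom|om [[hom ht1] ht2] i] /=.
  by split; [split|]; [move=> i it; apply/hom/ltnW | |]; case: (hom t).
by rewrite ltnS leq_eqVlt => /orP[/eqP->|/hom].
Qed.

Lemma past0 : past seed obs 0 h = [set: Omega]%classic.
Proof. by apply/seteqP; split. Qed.

Lemma measurable_past t : (t <= T)%N -> measurable (past seed obs t h).
Proof.
elim: t => [_|t IH tT]; first by rewrite past0.
have [ms mo _] := run tT; rewrite past_recr.
by apply: measurableI => //; apply: measurableI => //; exact/IH/ltnW.
Qed.

(** As the seed sets are deterministic, the event fixing the seed of a round contains the past, and
    each round contributes only the factor of its diffusion. *)
Lemma past_prob t : (t <= T)%N ->
  (forall i om, (i < t)%N -> seed i om = (h i).1) ->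
  P (past seed obs t h) =
  (\prod_(i < t) diffusion_law E mdl w (h i).1 (h i).2)%:E.
Proof.
elim: t => [_ _|t IH tT seedh]; first by rewrite past0 probability_setT big_ord0.
have [_ _ lawE] := run tT.
rewrite past_recr lawE big_ord_recr /= EFinM; congr (_ * _)%E.
rewrite (_ : (past seed obs t h `&` _)%classic = past seed obs t h).
  by apply: IH => [|i om it]; [exact: ltnW|apply/seedh/ltnW].
by apply/seteqP; split=> [om []//|om hom]; split=> //=; exact: seedh.
Qed.

End Past.

(** Turns an exploration history, which ranges over a finite type, into the infinite sequence that
    [estimate] takes. *)
Definition extend (y : {ffun 'I_N -> trace V}) (i : nat) : trace V :=
  if insub i is Some j then y j else [tuple finset.set0 | _ < _].

Lemma extendE y (i : 'I_N) : extend y i = y i.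
Proof. by rewrite /extend valK. Qed.

Definition explore_law (i : 'I_N) := diffusion_law E mdl w (explored i).

Definition history (om : Omega) : {ffun 'I_N -> trace V} :=
  [ffun i : 'I_N => obs i om].

(** The pair of the exploration history and the first exploitation seed has finite range, and its
    joint law is the product law of the traces times the oracle's conditional law. *)
Lemma integral_history (phi : {set V} -> R) : (N < T)%N ->
  (\int[P]_om (phi (seed N om))%:E =
   (prod_exp explore_law (fun y =>
     \sum_A oracle (estimate R E k (extend y)) A * phi A))%:E)%E.
Proof.
move=> NT; have [_ oracleE _] := plays.
pose c om := (history om, seed N om).
pose h y (i : nat) := (explored i, extend y i).
have cE y A : [set om | c om = (y, A)]%classic =
    (past seed obs N (h y) `&` [set om | seed N om = A])%classic.
  apply/seteqP; split=> om /=.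
    case=> <- <-; split=> // i iN; split=> /=.
      exact/seed_explored/(ltn_trans iN).
    by rewrite -[i]/(nat_of_ord (Ordinal iN)) extendE ffunE.
  case=> past_om <-; congr (_, _); apply/ffunP => i; rewrite ffunE.
  by have [_ ->] := past_om i (ltn_ord i); rewrite /= extendE.
have mc z : measurable [set om | c om = z]%classic.
  case: z => y A; rewrite cE; apply: measurableI.
    exact/measurable_past/ltnW.
  by have [] := run NT.
rewrite (integral_finite_range P mc (fun z => phi z.2)); congr _%:E.
rewrite (eq_bigr (fun z => pmf P c (z.1, z.2) * phi z.2)); last by case.
rewrite -(pair_bigA _ (fun y A => pmf P c (y, A) * phi A)) /=.
apply: eq_bigr => y _; rewrite mulr_sumr; apply: eq_bigr => A _.
rewrite mulrA /pmf cE oracleE // past_prob ?(ltnW NT) //; last first.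
  by move=> i om iN; apply/seed_explored/(ltn_trans iN).
rewrite -EFinM /=; congr (_ * _ * _).
by apply: eq_bigr => i _; rewrite extendE.
Qed.

Section Regret.
Variables (K : nat) (alpha beta : R).

Definition loss A : R := alpha * beta * opt E mdl K w - spread E mdl w A.

Lemma regretE : regret E P seed mdl K w alpha beta T =
  (\int[P]_om (\sum_(t < T) loss (seed t om))%:E)%E.
Proof.
rewrite /regret unlock; apply: eq_integral => om _; congr _%:E.
rewrite /loss sumrB sumr_const card_ord -mulr_natr; congr (_ - _); ring.
Qed.

Lemma regret_explore : (T <= N)%N ->
  regret E P seed mdl K w alpha beta T =
  (\sum_(t < T) loss (explored t))%:E.
Proof.
move=> TN; rewrite regretE.
under eq_integral => om _.
  rewrite (eq_bigr (fun t : 'I_T => loss (explored t))); last first.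
    by move=> t _; rewrite seed_explored // (leq_trans (ltn_ord t)).
  over.
by rewrite integral_cst // [X in (_ * X)%E]probability_setT mule1.
Qed.

(** Exploration losses are deterministic, and all exploitation rounds repeat the seed set of round
    [N], so only the law of that set enters. *)
Lemma regret_exploit : is_weight E w ->
  (forall y, \sum_A oracle (estimate R E k y) A = 1) -> (N < T)%N ->
  regret E P seed mdl K w alpha beta T =
  (\sum_(t < N) loss (explored t) + (T - N)%:R * prod_exp explore_law (fun y =>
     \sum_A oracle (estimate R E k (extend y)) A * loss A))%:E.
Proof.
move=> wE oracle1 NT; rewrite regretE.
have [_ _ seedT] := plays.
pose F A := \sum_(t < N) loss (explored t) + (T - N)%:R * loss A.
transitivity (\int[P]_om (F (seed N om))%:E)%E.
  apply: eq_integral => om _; congr _%:E; rewrite /F.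
  rewrite -!(big_mkord xpredT (fun t => loss (explored t))).
  rewrite -(big_mkord xpredT (fun t => loss (seed t om))).
  rewrite (big_cat_nat (n := N)) ?(ltnW NT) //=; congr (_ + _).
    apply: eq_big_nat => t /andP[_ tN].
    by rewrite seed_explored // (ltn_trans tN).
  rewrite (eq_big_nat _ _ (F2 := fun=> loss (seed N om))).
    by rewrite sumr_const_nat mulr_natl.
  move=> t /andP[]; rewrite leq_eqVlt => /orP[/eqP <- //|Nt tT].
  by rewrite seedT // Nt.
rewrite (integral_history F) //; congr _%:E.
have dlaw i : is_dist (explore_law i) by exact: diffusion_law_dist.
rewrite -[X in _ = X + _](prod_exp_cst dlaw) -prod_expZl -prod_expD.
apply: eq_prod_exp => y; under eq_bigr do rewrite mulrDr.
rewrite big_split /= -mulr_suml oracle1 mul1r; congr (_ + _).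
by rewrite mulr_sumr; apply: eq_bigr => A _; rewrite mulrCA.
Qed.

End Regret.
End OnlineRun.

(** * Estimation error and oracle loss *)

Section EstimationError.
Variables (R : realType) (V : finType) (E : {set V * V}).
Variables (mdl : diffusion_model) (w : V * V -> R) (k : nat).
Hypothesis wE : is_weight E w.

Lemma estimate_weight y : is_weight E (estimate R E k y).
Proof.
move=> e eE; rewrite /estimate eE; apply/andP; split.
  by rewrite divr_ge0 // sumr_ge0.
(* For [k = 0] the quotient is 0, since the inverse of 0 is 0. *)
have [->|k0] := eqVneq k 0%N; first by rewrite invr0 mulr0.
rewrite ler_pdivrMr ?ltr0n ?lt0n // mul1r.
apply: (@le_trans _ _ (\sum_(s < k) 1)); last by rewrite sumr_const card_ord.
by apply: ler_sum => s _; case: first_step.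
Qed.

Definition round_of (e : V * V) (s : 'I_k) : 'I_(#|V| * k) :=
  Ordinal (explore_round_lt s e.1).

Lemma round_of_inj e : injective (round_of e).
Proof.
by move=> s s' /(congr1 val) /explore_round_inj; exact: val_inj.
Qed.

Definition new_at_1 (e : V * V) (y : trace V) : bool :=
  e.2 \in state y 1 :\: state y 0.

Let law := @explore_law R V E mdl w k.

Lemma law_dist i : is_dist (law i).
Proof. exact: diffusion_law_dist. Qed.

Lemma new_at_1_prob e : e \in E -> e.1 != e.2 -> forall s : 'I_k,
  \sum_y law (round_of e s) y * (new_at_1 e y)%:R = w e.
Proof.
case: e => u v uvE uv s; rewrite /law /explore_law /= explored_round.
exact: first_step_prob.
Qed.

Lemma estimate_deviation e y : (0 < k)%N -> e \in E ->
  deviation (round_of e) (new_at_1 e) (w e) y =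
  k%:R * (estimate R E k (extend y) e - w e).
Proof.
move=> k0 eE; rewrite /estimate eE /deviation sumrB sumr_const card_ord.
rewrite mulrBr mulrC divfK ?pnatr_eq0 -?lt0n // mulr_natl; congr (_ - _).
apply: eq_bigr => s _; rewrite /first_step /new_at_1.
by rewrite -[explore_round s e.1]/(nat_of_ord (round_of e s)) extendE.
Qed.

Definition estimation_error (y : {ffun 'I_(#|V| * k) -> trace V}) : R :=
  \sum_(e in E | e.1 != e.2) `|estimate R E k (extend y) e - w e|.

Lemma estimation_error_ge0 y : 0 <= estimation_error y.
Proof. exact: sumr_ge0. Qed.

Lemma estimation_error_mean : (0 < k)%N ->
  prod_exp law estimation_error <= #|E|%:R * (3 / 2 / Num.sqrt k%:R).
Proof.
move=> k0; rewrite /estimation_error prod_exp_sum.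
have r0 : 0 < Num.sqrt k%:R :> R by rewrite sqrtr_gt0 ltr0n.
apply: (@le_trans _ _ (\sum_(e in E) 3 / 2 / Num.sqrt k%:R)); last first.
  by rewrite sumr_const -[leLHS]mulr_natl.
rewrite big_mkcondr /=; apply: ler_sum => e eE; case: ifPn => ee; last first.
  by rewrite !divr_ge0 // ltW.
have := deviation_mean law_dist (@round_of_inj e) (new_at_1_prob eE ee)
  (wE eE) k0.
under eq_prod_exp => y.
  rewrite estimate_deviation // normrM ger0_norm //; over.
rewrite prod_expZl; set X := prod_exp _ _.
set r := Num.sqrt _ in r0 *; have -> : k%:R = r ^+ 2 by rewrite sqr_sqrtr.
move=> H; rewrite ler_pdivlMr // -(ler_pM2r r0); apply: le_trans H.
by rewrite -mulrA mulrC expr2.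
Qed.

(** Union bound over the edges. For each edge, [k] times the estimation error is a deviation of [k]
    observations made in distinct rounds. *)
Lemma estimation_error_tail eps : (0 < k)%N -> 0 <= eps ->
  prod_exp law (fun y => [exists e in E, (e.1 != e.2) &&
    (eps <= `|estimate R E k (extend y) e - w e|)]%:R) <=
  #|E|%:R * (2 * expR (- (2 * k%:R * eps ^+ 2))).
Proof.
move=> k0 eps0.
apply: (@le_trans _ _ (prod_exp law (fun y => \sum_(e in E | e.1 != e.2)
    (eps <= `|estimate R E k (extend y) e - w e|)%R%:R))).
  apply: prod_exp_le => [i|y]; first exact: law_dist.
  case: existsP => [[e /and3P[eE ee le_e]]|_]; last exact: sumr_ge0.
  by rewrite (bigD1 e) ?eE //= le_e lerDl sumr_ge0.
rewrite prod_exp_sum.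
apply: (@le_trans _ _ (\sum_(e in E) 2 * expR (- (2 * k%:R * eps ^+ 2)))); last first.
  by rewrite sumr_const -[leLHS]mulr_natl.
rewrite big_mkcondr /=; apply: ler_sum => e eE; case: ifPn => ee; last first.
  by rewrite mulr_ge0 // expR_ge0.
have := deviation_tail law_dist (@round_of_inj e) (new_at_1_prob eE ee)
  (wE eE) eps0.
under eq_prod_exp => y.
  rewrite estimate_deviation // normrM ger0_norm // ler_pM2l ?ltr0n //; over.
by [].
Qed.

End EstimationError.

(** * Loss of the oracle's output computed from perturbed weights *)

Section OracleLoss.
Variables (R : realType) (V : finType) (E : {set V * V}).
Variables (mdl : diffusion_model) (w : V * V -> R) (K : nat) (alpha beta : R).
Variable oracle : (V * V -> R) -> {set V} -> R.
Hypothesis wE : is_weight E w.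
Hypothesis alpha01 : 0 <= alpha <= 1.
Hypothesis beta01 : 0 <= beta <= 1.
Hypothesis approx : approximation_oracle E mdl K alpha beta oracle.
Hypothesis bad_nonempty : bad_seeds E mdl K w alpha != finset.set0.
Implicit Types (A S : {set V}).

Let n : R := #|V|%:R.
Let opt_w := opt E mdl K w.
Let Dmax := gap_max E mdl K w alpha.
Let Dmin := gap_min E mdl K w alpha.
Let Loss := loss E mdl w K alpha beta.

Lemma opt_ge (w' : V * V -> R) S :
  S \in feasible V K -> spread E mdl w' S <= opt E mdl K w'.
Proof. by move=> SK; rewrite /opt; exact: le_bigmax_cond. Qed.

Lemma opt_ge0 (w' : V * V -> R) : 0 <= opt E mdl K w'.
Proof. exact: bigmax_ge_id. Qed.

Lemma opt_le : opt_w <= n.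
Proof. by apply: bigmax_le => // S _; exact: spread_le_card. Qed.

Lemma bad_le A : A \in bad_seeds E mdl K w alpha ->
  spread E mdl w A <= alpha * opt_w - Dmin.
Proof. by move=> Ab; rewrite /Dmin /gap_min subKr; exact: le_bigmax_cond. Qed.

Lemma bad_ge A : A \in bad_seeds E mdl K w alpha ->
  alpha * opt_w - Dmax <= spread E mdl w A.
Proof. by move=> Ab; rewrite /Dmax /gap_max subKr; exact: bigmin_le_cond. Qed.

Lemma gap_min_gt0 : 0 < Dmin.
Proof.
have /set0Pn[A Ab] := bad_nonempty.
rewrite subr_gt0; apply: bigmax_lt.
  move: Ab; rewrite inE => /andP[_]; apply: le_lt_trans; exact: spread_ge0.
by move=> S; rewrite inE => /andP[_].
Qed.

Lemma gap_min_le_max : Dmin <= Dmax.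
Proof.
have /set0Pn[A Ab] := bad_nonempty.
have := bad_le Ab; have := bad_ge Ab; lra.
Qed.

Lemma gap_min_le_card : Dmin <= n.
Proof.
have /andP[a0 a1] := alpha01.
rewrite /Dmin /gap_min; apply: (@le_trans _ _ opt_w); last exact: opt_le.
have : 0 <= \big[Num.max/0]_(S in bad_seeds E mdl K w alpha) spread E mdl w S.
  exact: bigmax_ge_id.
have : alpha * opt_w <= opt_w by rewrite ler_piMl // opt_ge0.
by rewrite /opt_w; lra.
Qed.

Lemma alpha_opt_ge0 : 0 <= alpha * opt_w.
Proof. by have /andP[a0 _] := alpha01; rewrite mulr_ge0 // opt_ge0. Qed.

Lemma beta_alpha_opt_le : alpha * beta * opt_w <= alpha * opt_w.
Proof.
have /andP[_ b1] := beta01.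
by rewrite mulrAC ler_piMr // alpha_opt_ge0.
Qed.

Lemma not_bad_ge A : A \in feasible V K -> A \notin bad_seeds E mdl K w alpha ->
  alpha * opt_w <= spread E mdl w A.
Proof. by move=> AK; rewrite inE AK /= -leNgt. Qed.

Lemma loss_le_gap_max A : A \in feasible V K -> Loss A <= Dmax.
Proof.
move=> AK; have := beta_alpha_opt_le; rewrite /Loss /loss -/opt_w.
have Dm : 0 <= Dmax by apply: le_trans (ltW gap_min_gt0) gap_min_le_max.
have [/bad_ge|/(not_bad_ge AK)] := boolP (A \in bad_seeds E mdl K w alpha).
  by lra.
by lra.
Qed.

Lemma loss_le_card A : (0 < #|A|)%N -> Loss A <= n - 1.
Proof.
move=> A0; rewrite /Loss /loss -/opt_w lerB //.
  apply: le_trans beta_alpha_opt_le _; apply: le_trans opt_le.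
  by have /andP[a0 a1] := alpha01; rewrite ler_piMl // opt_ge0.
by apply: le_trans (spread_ge_card mdl A wE); rewrite ler1n.
Qed.

Section Perturbed.
Variables (w' : V * V -> R) (D : R).
Hypothesis w'E : is_weight E w'.
Hypothesis close : forall S, `|spread E mdl w' S - spread E mdl w S| <= D.

Let D_ge0 : 0 <= D.
Proof. exact: le_trans (close finset.set0). Qed.

Lemma opt_perturbed : opt_w <= opt E mdl K w' + D.
Proof.
apply: bigmax_le => [|S SK]; first by rewrite addr_ge0 ?opt_ge0.
have := opt_ge w' SK; have := close S; rewrite ler_norml => /andP[]; lra.
Qed.

(** One [D] is lost on the spread of [A], and [alpha * D <= D] on the optimum. *)
Lemma approx_spread A : alpha * opt E mdl K w' <= spread E mdl w' A ->
  alpha * opt_w - 2 * D <= spread E mdl w A.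
Proof.
have /andP[a0 a1] := alpha01.
have := ler_wpM2l a0 opt_perturbed; rewrite mulrDr.
have : alpha * D <= D by rewrite ler_piMl.
have := close A; rewrite ler_norml => /andP[]; lra.
Qed.

(** The output is [alpha]-optimal for [w'] with some probability [q >= beta]. Dropping the other
    outputs, the expected spread is at least [q * (alpha * opt_w - c)], and [beta <= q <= 1] gives
    the bound. *)
Lemma oracle_loss_le c : 0 <= c ->
  (forall A, A \in feasible V K ->
     alpha * opt E mdl K w' <= spread E mdl w' A ->
     alpha * opt_w - c <= spread E mdl w A) ->
  \sum_A oracle w' A * Loss A <= c.
Proof.
move=> c0 good_ge; have [nn0 o1 oK obeta] := approx w'E.
set good := fun A => alpha * opt E mdl K w' <= spread E mdl w' A.
set q := \sum_(A | good A) oracle w' A in obeta.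
have q1 : q <= 1.
  by rewrite -o1 [leRHS](bigID good) /= lerDl sumr_ge0.
have lower : q * (alpha * opt_w - c) <= \sum_A oracle w' A * spread E mdl w A.
  rewrite mulr_suml [leRHS](bigID good) /= -[leLHS]addr0 lerD //; last first.
    by apply: sumr_ge0 => A _; rewrite mulr_ge0 // spread_ge0.
  apply: ler_sum => A gA; have [AK|/oK ->] := boolP (A \in feasible V K).
    by rewrite ler_wpM2l // good_ge.
  by rewrite !mul0r.
have -> : \sum_A oracle w' A * Loss A =
    alpha * beta * opt_w - \sum_A oracle w' A * spread E mdl w A.
  rewrite /Loss /loss; under eq_bigr do rewrite mulrBr.
  by rewrite sumrB -mulr_suml o1 mul1r.
have qb : beta * (alpha * opt_w) <= q * (alpha * opt_w).
  by rewrite ler_wpM2r // alpha_opt_ge0.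
have qc : q * c <= c by rewrite ler_piMl.
move: lower; rewrite mulrBr => lower.
have -> : alpha * beta * opt_w = beta * (alpha * opt_w) by ring.
lra.
Qed.

Lemma oracle_loss_close : \sum_A oracle w' A * Loss A <= 2 * D.
Proof.
by apply: oracle_loss_le => [|A _]; [rewrite mulr_ge0|exact: approx_spread].
Qed.

(** Bad sets fall short of [alpha * opt_w] by at least [Dmin], whereas sets that are [alpha]-optimal
    for [w'] fall short by at most [2 * D]; hence the latter are not bad. *)
Lemma oracle_loss_gap : 2 * D < Dmin -> \sum_A oracle w' A * Loss A <= 0.
Proof.
move=> DD; apply: oracle_loss_le => // A AK /approx_spread sA; rewrite subr0.
apply: not_bad_ge => //; apply/negP => /bad_le; lra.
Qed.

End Perturbed.

Lemma oracle_loss_max w' : is_weight E w' ->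
  \sum_A oracle w' A * Loss A <= Dmax.
Proof.
move=> w'E; have [nn0 o1 oK _] := approx w'E.
rewrite -[leRHS]mul1r -o1 mulr_suml; apply: ler_sum => A _.
have [AK|/oK ->] := boolP (A \in feasible V K); last by rewrite !mul0r.
by rewrite ler_wpM2l // loss_le_gap_max.
Qed.

End OracleLoss.

(** * Regret bounds *)

Section RegretBounds.
Variables (R : realType) (V : finType) (E : {set V * V}).
Variables (mdl : diffusion_model) (w : V * V -> R) (K k T : nat).
Variables (alpha beta : R) (oracle : (V * V -> R) -> {set V} -> R).
Variables (d : measure_display) (Omega : measurableType d).
Variables (P : probability Omega R).
Variables (seed : nat -> Omega -> {set V}) (obs : nat -> Omega -> trace V).
Hypothesis wE : is_weight E w.
Hypothesis K0 : (0 < K)%N.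
Hypothesis alpha01 : 0 <= alpha <= 1.
Hypothesis beta01 : 0 <= beta <= 1.
Hypothesis approx : approximation_oracle E mdl K alpha beta oracle.
Hypothesis bad_nonempty : bad_seeds E mdl K w alpha != finset.set0.
Hypothesis run : online_run E P seed obs mdl w T.
Hypothesis plays : plays_oim_etc E P seed obs k T oracle.

Let n : R := #|V|%:R.
Let m : R := #|E|%:R.
Let Dmax := gap_max E mdl K w alpha.
Let Dmin := gap_min E mdl K w alpha.
Let N := (#|V| * k)%N.
Let reg := regret E P seed mdl K w alpha beta T.
Let Loss := loss E mdl w K alpha beta.

Let Dmin0 : 0 < Dmin. Proof. exact: gap_min_gt0. Qed.
Let Dmax0 : 0 < Dmax. Proof. by apply: lt_le_trans Dmin0 _; apply: gap_min_le_max. Qed.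
Let n0 : 0 < n. Proof. by apply: lt_le_trans Dmin0 _; apply: gap_min_le_card. Qed.
Let V0 : (0 < #|V|)%N. Proof. by rewrite -(ltr0n R). Qed.

Lemma exploredP t : exists u, explored V t = [set u]%SET.
Proof.
pose u := enum_val (Ordinal (ltn_pmod t V0)); exists u.
apply/finset.setP => v; rewrite !inE -(inj_eq enum_rank_inj) enum_valK.
by rewrite -(inj_eq val_inj).
Qed.

Definition exploit_loss (y : {ffun 'I_N -> trace V}) : R :=
  \sum_A oracle (estimate R E k (extend y)) A * Loss A.

Let law := @explore_law R V E mdl w k.
Let law_d i : is_dist (law i). Proof. exact: law_dist. Qed.

(** The number of exploration rounds is [minn T N], which covers the case where the budget exhausts
    the horizon. *)
Lemma regret_le c b : (forall t, Loss (explored V t) <= c) ->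
  ((N < T)%N -> (T - N)%:R * prod_exp law exploit_loss <= b) -> 0 <= b ->
  (reg <= ((minn T N)%:R * c + b)%:E)%E.
Proof.
move=> lossc exploitb b0; rewrite /reg.
have [TN|NT] := leqP T N.
  rewrite (regret_explore _ _ plays) // lee_fin -[leLHS]addr0.
  rewrite lerD // -[T in leRHS]card_ord mulr_natl -sumr_const.
  by apply: ler_sum.
rewrite (regret_exploit run plays) //; last first.
  by move=> y; have [] := approx (estimate_weight R k y).
rewrite lee_fin lerD //; last exact: exploitb.
by rewrite -[N in leRHS]card_ord mulr_natl -sumr_const; apply: ler_sum.
Qed.

Lemma spread_estimate (y : {ffun 'I_(#|V| * k) -> trace V}) S :
  `|spread E mdl (estimate R E k (extend y)) S - spread E mdl w S| <=
  #|heads E|%:R * estimation_error E w y.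
Proof. by apply: spread_lipschitz => //; exact: estimate_weight. Qed.

Lemma loss_explored_gap t : Loss (explored V t) <= Dmax.
Proof.
apply: loss_le_gap_max => //; have [u ->] := exploredP t.
by rewrite inE cards1.
Qed.

Lemma loss_explored_card t : Loss (explored V t) <= n - 1.
Proof. by apply: loss_le_card => //; have [u ->] := exploredP t; rewrite cards1. Qed.

Lemma regret_le_trivial : (reg <= (T%:R * Dmax)%:E)%E.
Proof.
have -> : T%:R * Dmax = (minn T N)%:R * Dmax + (T - N)%:R * Dmax.
  by rewrite -mulrDl -natrD minnE subnK ?leq_subr.
apply: regret_le; first exact: loss_explored_gap.
  move=> _; rewrite ler_wpM2l //.
  rewrite -[leRHS](prod_exp_cst law_d).
  apply: prod_exp_le => // y.
  exact: (oracle_loss_max wE alpha01 beta01 approx bad_nonempty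
    (estimate_weight R k _)).
by rewrite mulr_ge0 // ltW.
Qed.

Lemma heads_nodes : #|heads E|%:R <= n.
Proof. by rewrite ler_nat card_heads_nodes. Qed.

Lemma heads_edges : #|heads E|%:R <= m.
Proof. by rewrite ler_nat card_heads_edges. Qed.

(** Without edges the spread is independent of the weights, so the oracle errs by nothing. This case
    is separate because the later computations divide by [m] or need it positive. *)
Lemma no_edges_exploit_loss y : #|E| = 0%N -> exploit_loss y <= 0.
Proof.
move=> E0; apply: (oracle_loss_gap wE alpha01 approx (estimate_weight R k _)
  (spread_estimate y)).
have -> : #|heads E| = 0%N by apply/eqP; rewrite -leqn0 -E0 card_heads_edges.
by rewrite mul0r mulr0.
Qed.

Lemma exploit_loss_gap : (0 < k)%N -> (0 < #|E|)%N ->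
  prod_exp law exploit_loss <=
  Dmax * (m * (2 * expR (- (k%:R / (2 * m ^+ 2 * n ^+ 2 / Dmin ^+ 2))))).
Proof.
move=> k0 E0; have m0 : 0 < m by rewrite ltr0n.
(* If all estimates are within [eps], the [m] errors and the Lipschitz factor [n] move each spread
   by less than [Dmin / 2], as [oracle_loss_gap] demands. *)
pose eps := Dmin / (2 * m * n).
have eps0 : 0 < eps by rewrite divr_gt0 // !mulr_gt0.
have -> : k%:R / (2 * m ^+ 2 * n ^+ 2 / Dmin ^+ 2) = 2 * k%:R * eps ^+ 2.
  by rewrite /eps; field; rewrite !gt_eqF.
apply: le_trans (ler_wpM2l (ltW Dmax0)
  (estimation_error_tail mdl wE k0 (ltW eps0))).
rewrite -prod_expZl; apply: prod_exp_le => // y.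
have [bad|good] := boolP [exists e in E,
  (e.1 != e.2) && (eps <= `|estimate R E k (extend y) e - w e|)].
  by rewrite mulr1; exact: (oracle_loss_max wE alpha01 beta01 approx bad_nonempty
    (estimate_weight R k _)).
rewrite mulr0; apply: (oracle_loss_gap wE alpha01 approx (estimate_weight R k _)
  (spread_estimate y)).
have err : estimation_error E w y < m * eps.
  rewrite /estimation_error big_mkcondr /m -sum1_card natr_sum mulr_suml.
  (* The strict inequality comes from the nonemptiness of [E]. *)
  apply: ltr_sum => [|e eE].
    by have /card_gt0P[e eE] := E0; apply/hasP; exists e; rewrite ?mem_index_enum.
  rewrite mul1r; case: ifP => // ee; rewrite ltNge; apply: contraNN good => le_e.
  by apply/existsP; exists e; rewrite eE ee.
have : n * estimation_error E w y < n * (m * eps) by rewrite ltr_pM2l.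
have : #|heads E|%:R * estimation_error E w y <= n * estimation_error E w y.
  by rewrite ler_wpM2r ?estimation_error_ge0 // heads_nodes.
have -> : n * (m * eps) = Dmin / 2 by rewrite /eps; field; rewrite !gt_eqF.
rewrite -/Dmin; lra.
Qed.

(** Here the Lipschitz constant is bounded by [m] rather than [n]: the loss is at most [2 * m] times
    an error of mean at most [m * (3 / 2) / sqrt k]. *)
Lemma exploit_loss_mean : (0 < k)%N ->
  prod_exp law exploit_loss <= 3 * m ^+ 2 / Num.sqrt k%:R.
Proof.
move=> k0; have r0 : 0 < Num.sqrt k%:R :> R by rewrite sqrtr_gt0 ltr0n.
apply: (@le_trans _ _ (prod_exp law (fun y => 2 * m * estimation_error E w y))).
  apply: prod_exp_le => // y.
  apply: le_trans (oracle_loss_close wE alpha01 approx (estimate_weight R k _)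
    (spread_estimate y)) _.
  by rewrite -mulrA ler_wpM2l // ler_wpM2r ?estimation_error_ge0 // heads_edges.
rewrite prod_expZl.
apply: le_trans (ler_wpM2l _ (estimation_error_mean mdl wE k0)) _.
  by rewrite mulr_ge0.
by rewrite -/m le_eqVlt; apply/orP; left; apply/eqP; field; rewrite gt_eqF.
Qed.

Let lg := ln (T%:R * Dmin ^+ 2 / (m * n ^+ 3)).

Lemma regret_le_gap :
  k%:R = Num.max 1 (2 * m ^+ 2 * n ^+ 2 / Dmin ^+ 2 * lg) ->
  (reg <= (n * Dmax + 2 * m ^+ 2 * n ^+ 3 * Dmax / Dmin ^+ 2
                          * (1 + Num.max 0 lg))%:E)%E.
Proof.
move=> kE; have k0 : (0 < k)%N.
  by rewrite -(ltr0n R) kE lt_max ltr01.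
set X := 2 * m ^+ 2 * n ^+ 2 / Dmin ^+ 2 in kE.
have X0 : 0 <= X by rewrite divr_ge0 ?mulr_ge0 ?exprn_ge0 // ltW.
have XnD0 : 0 <= X * n * Dmax by rewrite mulr_ge0 ?(mulr_ge0 X0) // ltW.
apply: le_trans (@regret_le Dmax (X * n * Dmax) loss_explored_gap _ _) _.
- move=> NT; have T0 : 0 < T%:R :> R by rewrite ltr0n (leq_ltn_trans _ NT).
  have [E0|] := posnP #|E|.
    apply: (@le_trans _ _ 0) => //.
    rewrite mulr_ge0_le0 // -(prod_exp_cst law_d 0).
    apply: prod_exp_le => // y.
    exact: no_edges_exploit_loss.
  move=> E0; have m0 : 0 < m by rewrite ltr0n.
  have Xgt0 : 0 < X by rewrite divr_gt0 ?mulr_gt0 ?exprn_gt0.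
  pose Z := T%:R * Dmin ^+ 2 / (m * n ^+ 3).
  have Z0 : 0 < Z by rewrite divr_gt0 ?mulr_gt0 ?exprn_gt0.
  (* The choice of [k] makes the Hoeffding exponential at most [Z^-1]. *)
  have kX : lg <= k%:R / X by rewrite ler_pdivlMr // mulrC kE le_max lexx orbT.
  have expk : expR (- (k%:R / X)) <= Z^-1.
    by rewrite -[Z in leRHS]lnK ?posrE // -expRN ler_expR lerN2.
  have bnd : prod_exp law exploit_loss <= Dmax * (m * (2 * Z^-1)).
    apply: le_trans (exploit_loss_gap k0 E0) _.
    by rewrite (ler_wpM2l (ltW Dmax0)) // (ler_wpM2l (ltW m0)) // ler_wpM2l.
  apply: (@le_trans _ _ (T%:R * (Dmax * (m * (2 * Z^-1))))).
    apply: (@le_trans _ _ ((T - N)%:R * (Dmax * (m * (2 * Z^-1))))).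
      by rewrite ler_wpM2l.
    by rewrite ler_wpM2r ?ler_nat ?leq_subr // !mulr_ge0 ?invr_ge0 // ltW.
  (* The horizon cancels against [Z], leaving exactly [X * n * Dmax]: this is the 1 in the factor
     [1 + Num.max 0 lg]. *)
  rewrite le_eqVlt; apply/orP; left; apply/eqP; rewrite /Z /X; field.
  by rewrite !gt_eqF.
- by [].
rewrite lee_fin.
have kle : k%:R <= 1 + X * Num.max 0 lg.
  rewrite kE ge_max lerDl mulr_ge0 ?le_max ?lexx //=.
  rewrite -[leLHS]add0r lerD // ler_wpM2l // le_max lexx orbT //.
have minle : (minn T N)%:R * Dmax <= n * (1 + X * Num.max 0 lg) * Dmax.
  apply: (ler_wpM2r (ltW Dmax0)); apply: (@le_trans _ _ N%:R).
    by rewrite ler_nat geq_minr.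
  by rewrite natrM (ler_wpM2l (ltW n0)).
have -> : 2 * m ^+ 2 * n ^+ 3 * Dmax / Dmin ^+ 2 = X * n * Dmax.
  by rewrite /X; field; rewrite gt_eqF.
lra.
Qed.

Lemma regret_le_power :
  k%:R = 39 / 10 * (m ^+ 2 * T%:R / n) `^ (2 / 3) ->
  (reg <= (39 / 10 * (m * n) `^ (4 / 3) * T%:R `^ (2 / 3) + 1)%:E)%E.
Proof.
move=> kE; set z := m ^+ 2 * T%:R / n in kE.
have z0 : 0 <= z by rewrite divr_ge0 ?mulr_ge0 ?exprn_ge0 // ltW.
(* An exploration round loses at most [n - 1] instead of [n]; the [N] units so saved pay for the
   whole exploitation phase. *)
apply: le_trans (@regret_le (n - 1) N%:R loss_explored_card _ _) _.
- move=> NT; have T0 : 0 < T%:R :> R by rewrite ltr0n (leq_ltn_trans _ NT).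
  have [E0|E0] := posnP #|E|.
    apply: (@le_trans _ _ 0) => //.
    rewrite mulr_ge0_le0 // -(prod_exp_cst law_d 0).
    apply: prod_exp_le => // y.
    exact: no_edges_exploit_loss.
  have m0 : 0 < m by rewrite ltr0n.
  have zp : 0 < z by rewrite divr_gt0 ?mulr_gt0 ?exprn_gt0.
  have k0 : (0 < k)%N by rewrite -(ltr0n R) kE mulr_gt0 // powR_gt0.
  pose r : R := Num.sqrt k%:R; have r0 : 0 < r by rewrite sqrtr_gt0 ltr0n.
  have rr : r ^+ 2 = k%:R by rewrite sqr_sqrtr.
  have z3 : (z `^ (2 / 3)) ^+ 3 = z ^+ 2.
    rewrite -powR_mulrn ?powR_ge0 // -powRrM -powR_mulrn ?ltW //.
    by congr (_ `^ _); field.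
  (* After squaring this is [9 * z ^+ 2 <= (39 / 10) ^+ 3 * z ^+ 2]. *)
  have zr : 3 * z <= r ^+ 3.
    have r_ge0 := ltW r0.
    have tz_ge0 : 0 <= 3 * z by exact: mulr_ge0.
    rewrite -(@ler_pXn2r _ 2) ?nnegrE ?tz_ge0 ?exprn_ge0 //.
    rewrite -exprM mulnC exprM rr kE (exprMn _ 3 z) (exprMn _ (39 / 10)) z3.
    by rewrite ler_wpM2r ?exprn_ge0 //; lra.
  apply: (@le_trans _ _ (T%:R * (3 * m ^+ 2 / r))).
    apply: (@le_trans _ _ ((T - N)%:R * (3 * m ^+ 2 / r))).
      by apply: ler_wpM2l => //; exact: exploit_loss_mean.
    apply: ler_wpM2r; last by rewrite ler_nat leq_subr.
    by rewrite divr_ge0 ?mulr_ge0 ?exprn_ge0 // ltW.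
  rewrite natrM -/n -rr mulrA ler_pdivrMr //.
  have -> : T%:R * (3 * m ^+ 2) = n * (3 * z).
    by rewrite /z; field; rewrite gt_eqF.
  by rewrite -mulrA -exprSr (ler_wpM2l (ltW n0)).
- by [].
rewrite lee_fin; apply: (@le_trans _ _ (n * (n * k%:R))).
  apply: (@le_trans _ _ (N%:R * (n - 1) + N%:R)).
    rewrite lerD // ler_wpM2r ?ler_nat ?geq_minr //.
    by rewrite subr_ge0 ler1n.
  by rewrite natrM -/n; lra.
rewrite kE -[leLHS]addr0 lerD // le_eqVlt; apply/orP; left; apply/eqP.
have nV : n^-1 `^ (2 / 3) = (n `^ (2 / 3))^-1.
  by rewrite -powR_inv1 ?ltW // -powRrM mulN1r powRN.
have m2 : (m ^+ 2) `^ (2 / 3) = m `^ (4 / 3).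
  by rewrite -powR_mulrn // -powRrM; congr (_ `^ _); field.
have -> : z `^ (2 / 3) = m `^ (4 / 3) * T%:R `^ (2 / 3) / n `^ (2 / 3).
  have mm0 : 0 <= m ^+ 2 by exact: exprn_ge0.
  rewrite /z (powRM _ (mulr_ge0 mm0 (ler0n _ _))) ?invr_ge0 ?(ltW n0) //.
  by rewrite (powRM _ mm0) // m2 nV.
rewrite (powRM _ _ (ltW n0)) //.
have -> : n `^ (4 / 3) = n ^+ 2 / n `^ (2 / 3).
  rewrite -powR_mulrn ?(ltW n0) // -powRN -powRD; last by rewrite (gt_eqF n0) implybT.
  by congr (_ `^ _); field.
have np : n `^ (2 / 3) != 0 by rewrite gt_eqF // powR_gt0.
by field; exact: np.
Qed.

(** Since [Dmin <= n] and [m, n >= 1], the argument of the logarithm is at most [T] and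
    [n * Dmax <= X]. The terms without logarithm add up to at most [3 * X], and [ln 2 <= ln T] turns
    them into the summand [3 / ln 2]. *)
Lemma gap_bound_log : (0 < #|E|)%N -> (2 <= T)%N ->
  n * Dmax + 2 * m ^+ 2 * n ^+ 3 * Dmax / Dmin ^+ 2 * (1 + Num.max 0 lg) <=
  (3 / ln 2 + 2) * (m ^+ 2 * n ^+ 3 * Dmax / Dmin ^+ 2 * ln T%:R).
Proof.
move=> E0 T2; have m1 : 1 <= m by rewrite ler1n.
have n1 : 1 <= n by rewrite ler1n.
have m0 : 0 < m := lt_le_trans ltr01 m1.
have T0 : 0 < T%:R :> R by rewrite ltr0n (ltn_trans _ T2).
have Dn : Dmin <= n by exact: gap_min_le_card.
have DD : Dmin ^+ 2 <= n ^+ 2 by rewrite lerXn2r ?nnegrE // ltW.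
have ln2 : 0 < ln 2 :> R by rewrite ln_gt0 // ltr1n.
have lnT : ln 2 <= ln T%:R :> R by rewrite ler_ln ?posrE // ler_nat.
set X := m ^+ 2 * n ^+ 3 * Dmax / Dmin ^+ 2.
have X0 : 0 <= X by rewrite divr_ge0 ?mulr_ge0 ?exprn_ge0 // ltW.
have nD : n * Dmax <= X.
  rewrite /X ler_pdivlMr ?exprn_gt0 //.
  have -> : m ^+ 2 * n ^+ 3 * Dmax = n * Dmax * (m ^+ 2 * n ^+ 2) by ring.
  rewrite (ler_wpM2l (mulr_ge0 (ltW n0) (ltW Dmax0))) //.
  apply: le_trans DD _.
  by rewrite ler_peMl ?exprn_ge0 ?exprn_ege1 // ltW.
have lgT : Num.max 0 lg <= ln T%:R.
  rewrite ge_max (le_trans (ltW ln2) lnT) /= /lg ler_ln ?posrE //; last first.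
    by rewrite divr_gt0 ?mulr_gt0 ?exprn_gt0.
  rewrite ler_pdivrMr ?mulr_gt0 ?exprn_gt0 // (ler_wpM2l (ltW T0)) //.
  apply: le_trans DD _; rewrite [n ^+ 3]exprS mulrA.
  by rewrite ler_peMl ?exprn_ge0 ?mulr_ege1 // ltW.
have Xl : X <= X / ln 2 * ln T%:R.
  by rewrite -mulrA ler_peMr // mulrC ler_pdivlMr // mul1r.
have := ler_wpM2l X0 lgT.
have -> : 2 * m ^+ 2 * n ^+ 3 * Dmax / Dmin ^+ 2 = 2 * X.
  by rewrite /X; ring.
have -> : (3 / ln 2 + 2) * (X * ln T%:R) =
  3 * (X / ln 2 * ln T%:R) + 2 * (X * ln T%:R) by ring.
lra.
Qed.

Lemma power_bound : (0 < #|E|)%N -> (1 <= T)%N ->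
  39 / 10 * (m * n) `^ (4 / 3) * T%:R `^ (2 / 3) + 1 <=
  49 / 10 * ((m * n) `^ (4 / 3) * T%:R `^ (2 / 3)).
Proof.
move=> E0 T1; have ge1 (x q : R) : 1 <= x -> 0 <= q -> 1 <= x `^ q.
  by move=> x1 q0; rewrite -(powRr0 x) ler_powR.
have : 1 <= (m * n) `^ (4 / 3) * T%:R `^ (2 / 3).
  apply: mulr_ege1; apply: ge1 => //; last by rewrite ler1n.
  by rewrite mulr_ege1 // ler1n.
lra.
Qed.

End RegretBounds.

Theorem theorem3 (R : realType) :
  exists C1 C2 : R, 0 < C1 /\ 0 < C2 /\
  forall (V : finType) (E : {set V * V}) (mdl : diffusion_model)
    (w : V * V -> R) (K k T : nat) (alpha beta : R)
    (oracle : (V * V -> R) -> {set V} -> R)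
    (d : measure_display) (Omega : measurableType d) (P : probability Omega R)
    (seed : nat -> Omega -> {set V}) (obs : nat -> Omega -> trace V),
  is_weight E w ->
  (mdl = LT -> lt_admissible E w) ->
  (0 < K)%N ->
  0 <= alpha <= 1 -> 0 <= beta <= 1 ->
  approximation_oracle E mdl K alpha beta oracle ->
  bad_seeds E mdl K w alpha != finset.set0 ->
  online_run E P seed obs mdl w T ->
  plays_oim_etc E P seed obs k T oracle ->
  let n : R := #|V|%:R in
  let m : R := #|E|%:R in
  let Dmax := gap_max E mdl K w alpha in
  let Dmin := gap_min E mdl K w alpha in
  let lg := ln (T%:R * Dmin ^+ 2 / (m * n ^+ 3)) in
  let B1 := Num.min (T%:R * Dmax)
              (n * Dmax + 2 * m ^+ 2 * n ^+ 3 * Dmax / Dmin ^+ 2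
                          * (1 + Num.max 0 lg)) in
  let B2 := 39 / 10 * (m * n) `^ (4 / 3) * T%:R `^ (2 / 3) + 1 in
  let reg := regret E P seed mdl K w alpha beta T in
  (k%:R = Num.max 1 (2 * m ^+ 2 * n ^+ 2 / Dmin ^+ 2 * lg) ->
     (reg <= B1%:E)%E /\
     ((0 < #|E|)%N -> (2 <= T)%N ->
        B1 <= C1 * (m ^+ 2 * n ^+ 3 * Dmax / Dmin ^+ 2 * ln T%:R)))
  /\
  (k%:R = 39 / 10 * (m ^+ 2 * T%:R / n) `^ (2 / 3) ->
     (reg <= B2%:E)%E /\
     ((0 < #|E|)%N -> (1 <= T)%N ->
        B2 <= C2 * ((m * n) `^ (4 / 3) * T%:R `^ (2 / 3)))).
Proof.
(* The second constant is 3.9 plus 1, the additive 1 being absorbed into a leading term that is at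
   least 1. *)
exists (3 / ln 2 + 2), (49 / 10).
have ln2 : 0 < ln 2 :> R by rewrite ln_gt0 // ltr1n.
split; first by rewrite addr_gt0 // divr_gt0.
split; first by rewrite divr_gt0.
move=> V E mdl w K k T alpha beta oracle d Omega P seed obs.
move=> wE _ K0 alpha01 beta01 approx bad_nonempty run plays n m Dmax Dmin lg.
move=> B1 B2 reg; split=> kE; split.
- rewrite /B1 /reg EFin_min le_min; apply/andP; split.
    exact: (regret_le_trivial wE K0 alpha01 beta01 approx bad_nonempty run plays).
  exact: (regret_le_gap wE K0 alpha01 beta01 approx bad_nonempty run plays).
- move=> E0 T2; rewrite /B1 ge_min; apply/orP; right.
  exact: gap_bound_log.
- exact: (regret_le_power wE alpha01 beta01 approx bad_nonempty run plays).
- exact: (power_bound wE alpha01 bad_nonempty).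
Qed.
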